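(* Let $\boldsymbol\alpha$ be an arbitrary sequence in $\mathbb D$, $\mu$ a measure on $\mathbb T$, $(\phi_n)_{n\ge0}$ the corresponding ORF, $(\chi_n)_{n\ge0}$ the ORF associated with $(\alpha_1,\hat\alpha_2,\alpha_3,\hat\alpha_4,\dots)$, $\mathcal A=\mathcal A(\boldsymbol\alpha)$ and $\mathcal C=\mathcal C(\boldsymbol a)$ with $\boldsymbol a=\mathcal S_{\boldsymbol\alpha}(\mu)$. Let $n\ge1$, $v\in\mathbb T$, let $Q_n^v=\phi_n+v\phi_n^*$ be the $n$-th para-orthogonal rational function related to $v$, and let $\mu_n^v$ be the associated measure. Then: 1. The matrix of $T_{\mu_n^v}$ with respect to $(\chi_k)_{k=0}^{n-1}$ is $$\mathcal U^{(n;u)}=\tilde\zeta_{\mathcal A_n}(\mathcal C_n^u),\qquad u=\tilde\zeta_{a_n}(v)=\frac{v+a_n}{1+\overline{a_n}v}.$$ 2. The zeros of $Q_n^v$ are the eigenvalues of $\mathcal U^{(n;u)}$. If $\lambda$ is a zero of $Q_n^v$, the related eigenvectors of $\mathcal U^{(n;u)}$ are spanned by $\begin{pmatrix}\chi_0(\lambda)&\cdots&\chi_{n-1}(\lambda)\end{pmatrix}^\dag$. 3. $Q_n^v=\dfrac{q_n^v}{\pi_n}$ with $q_n^v$ proportional to the characteristic polynomial of $\mathcal U^{(n;u)}$.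
   Context: $\mathbb T$ is the unit circle, $\mathbb D$ the open unit disk. A measure $\mu$ on $\mathbb T$ (as in the hypothesis) is a probability Borel measure on $\mathbb T$ with infinite support. $L^2_\mu$ carries the inner product $\langle f,g\rangle_\mu=\int\overline{f}\,g\,d\mu$. For any probability Borel measure $\nu$ on $\mathbb T$ (possibly finitely supported), $T_\nu$ is the operator $f(z)\mapsto zf(z)$ on $L^2_\nu$. ORF. Let $\boldsymbol\alpha=(\alpha_n)_{n\ge1}$ be a sequence in $\mathbb D$ and set $\alpha_0=0$. For $n\ge0$ let $\varpi_n(z)=1-\overline{\alpha_n}z$, $\varpi_n^*(z)=z-\alpha_n$, $\zeta_n=\varpi_n^*/\varpi_n$; $\pi_n=\varpi_1\cdots\varpi_n$. Let $B_0=1$, $B_n=\zeta_1\cdots\zeta_n$, $f_*(z)=\overline{f(1/\overline z)}$ and $\hat z=1/\overline z$ (with $\hat 0=\infty$). The orthogonal rational functions (ORF) $(\phi_n)_{n\ge0}$ of $\mu$ associated with $\boldsymbol\alpha$ are the result of orthonormalizing $(B_n)_{n\ge0}$ in $L^2_\mu$ (so $\phi_0,\dots,\phi_n$ is an orthonormal basis of $\operatorname{span}\{B_0,\dots,B_n\}$ for every $n$), with unimodular factors chosen so that $\phi_0=1$ and, with $\phi_n^*=B_n\phi_{n*}$, $$\begin{pmatrix}\phi_n\\ \phi_n^*\end{pmatrix}=e_n\frac{\varpi_{n-1}}{\varpi_n}\begin{pmatrix}1&a_n\\ \overline{a_n}&1\end{pmatrix}\begin{pmatrix}\zeta_{n-1}\phi_{n-1}\\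 \phi_{n-1}^*\end{pmatrix},\quad e_n=\sqrt{\frac{\varpi_n(\alpha_n)}{\varpi_{n-1}(\alpha_{n-1})}\frac1{1-|a_n|^2}},\quad n\ge1,$$ for some $a_n\in\mathbb D$. This normalization exists and both $(\phi_n)$ and $\boldsymbol a=(a_n)_{n\ge1}$ are then uniquely determined; one writes $\boldsymbol a=\mathcal S_{\boldsymbol\alpha}(\mu)$. Put $B_0^e=1$ and $B_n^e=\zeta_2\zeta_4\cdots\zeta_{2n}$. The ORF $(\chi_n)_{n\ge0}$ associated with $(\alpha_1,\hat\alpha_2,\alpha_3,\hat\alpha_4,\dots)$ are $\chi_{2n}=B^e_{n*}\phi_{2n}^*$, $\chi_{2n+1}=B^e_{n*}\phi_{2n+1}$, $n\ge0$. The function $Q_n^v$ has $n$ different zeros, all lying on $\mathbb T$. The measure $\mu_n^v$ associated with $Q_n^v$ is the measure supported on these zeros with mass $\big(\sum_{k=0}^{n-1}|\phi_k(\lambda)|^2\big)^{-1}$ at each zero $\lambda$; both $(\phi_k)_{k=0}^{n-1}$ and $(\chi_k)_{k=0}^{n-1}$ are orthonormal bases of the $n$-dimensional space $L^2_{\mu_n^v}$ (exactness of the rational Szegő quadrature formula). Matrices. The matrix of an operator $T$ with respect to an orthonormal basis $(f_k)$ has entries $\langle f_i,Tf_j\rangle$. $\mathcal A(\boldsymbol\alpha)=\operatorname{diag}(\alpha_0,\alpha_1,\alpha_2,\dots)$. With $\rho_n=\sqrt{1-|a_n|^2}$ and $\Theta_n=\begin{pmatrix}-a_n&\rho_n\\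 \rho_n&\overline{a_n}\end{pmatrix}$, $\mathcal C(\boldsymbol a)=\mathcal C_o\mathcal C_e$ is the five-diagonal unitary matrix with $\mathcal C_o=\Theta_1\oplus\Theta_3\oplus\Theta_5\oplus\cdots$ and $\mathcal C_e=1\oplus\Theta_2\oplus\Theta_4\oplus\cdots$ (here $1$ is a $1\times1$ block). A subscript ${}_n$ on a matrix denotes its principal submatrix of order $n$ (first $n$ rows and columns). $\mathcal C_n$ depends only on $a_1,\dots,a_n$ and not on $\rho_n$; $\mathcal C_n^u$ is the (unitary) matrix obtained from $\mathcal C_n$ by replacing $a_n$ by $u\in\mathbb T$. Operator Möbius transformation. For operators (matrices) $A,T$ with $\|A\|<1$, $\|T\|\le1$, set $\eta_A=\sqrt{1-AA^\dag}$ and $\tilde\zeta_A(T)=\eta_A^{-1}(T+A)(1+A^\dag T)^{-1}\eta_{A^\dag}$. The superscript $\dag$ denotes conjugate transpose. *)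

(* Defs.v *)
From HB Require Import structures.
From mathcomp Require Import all_boot all_order all_algebra.
From mathcomp Require Import generic_quotient spectral complex.
From mathcomp Require Import all_classical all_reals all_analysis.

Set Implicit Arguments.
Unset Strict Implicit.
Unset Printing Implicit Defensive.

Import Order.TTheory GRing.Theory Num.Theory.
Import numFieldNormedType.Exports.

Local Open Scope quotient_scope.
Local Open Scope sesquilinear_scope.
Local Open Scope classical_set_scope.
Local Open Scope ring_scope.

Notation "x %:F" := (FracField.tofrac x) : ring_scope.

Section BorelMeasures.
Variable R : realType.
Local Notation C := R[i].

Definition borelC := g_sigma_algebraType (@open (C : numFieldType)).

Definition unit_circle : set borelC := [set z : C | `|z| = 1].

Definition msupport (mu : {measure set borelC -> \bar R}) : set borelC :=
  [set z | forall U : set (C : numFieldType), open U -> U z ->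
    (0 < mu (U : set borelC))%E].

(* Measures on the unit circle are Borel measures on the plane carried by it;
   [borelC] carries the Borel sigma-algebra of the plane. *)
Definition circle_measure (mu : probability borelC R) : Prop :=
  mu unit_circle = 1%E /\ infinite_set (msupport mu).

Definition normsq (z : C) : R := complex.Re z ^+ 2 + complex.Im z ^+ 2.

Definition cintegral (nu : {measure set borelC -> \bar R})
    (f : borelC -> C) : C :=
  Complex (\int[nu]_(z in unit_circle) complex.Re (f z))
          (\int[nu]_(z in unit_circle) complex.Im (f z)).

Definition L2 (nu : {measure set borelC -> \bar R}) (f : borelC -> C) : Prop :=
  [/\ measurable_fun unit_circle (fun z => complex.Re (f z)),
      measurable_fun unit_circle (fun z => complex.Im (f z)) &
      (\int[nu]_(z in unit_circle) (normsq (f z))%:E < +oo)%E].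

Definition inner (nu : {measure set borelC -> \bar R}) (f g : borelC -> C) : C :=
  cintegral nu (fun z => (f z)^* * g z).

Definition orthonormal (nu : {measure set borelC -> \bar R}) n
    (f : 'I_n -> borelC -> C) : Prop :=
  (forall i, L2 nu (f i)) /\
  (forall i j, inner nu (f i) (f j) = (i == j)%:R).

Definition orthonormal_basis (nu : {measure set borelC -> \bar R}) n
    (f : 'I_n -> borelC -> C) : Prop :=
  orthonormal nu f /\
  (forall g, L2 nu g -> exists c : 'I_n -> C,
     {ae nu, forall z, unit_circle z -> g z = \sum_(i < n) c i * f i z}).

Definition mult_op (f : borelC -> C) : borelC -> C := fun z => (z : C) * f z.

Definition is_matrix_of (nu : {measure set borelC -> \bar R})
    (T : (borelC -> C) -> (borelC -> C)) n (f : 'I_n -> borelC -> C)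
    (M : 'M[C]_n) : Prop :=
  orthonormal_basis nu f /\ (forall i j, M i j = inner nu (f i) (T (f j))).

End BorelMeasures.

(* Rational functions are elements of the field C(z), so that identities
   between them and their zeros do not depend on removable singularities. *)
Section RationalFunctions.
Variable R : realType.
Local Notation C := R[i].

Definition ratfun := {fraction {poly C}}.

Definition rconst (c : C) : ratfun := (c%:P)%:F.
Definition rvar : ratfun := ('X : {poly C})%:F.

(* Numerator and denominator in lowest terms, up to a common nonzero
   constant. *)
Definition rnum (f : ratfun) : {poly C} :=
  let: (p, q) := frac (repr f) in p %/ gcdp p q.
Definition rden (f : ratfun) : {poly C} :=
  let: (p, q) := frac (repr f) in q %/ gcdp p q.

Definition reval (f : ratfun) (z : C) : C := (rnum f).[z] / (rden f).[z].

Definition rzero (f : ratfun) (z : C) : Prop := root (rnum f) z.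

(* f_*(z) = conj (f (1 / conj z)): conjugate the coefficients of f and
   substitute 1/z. *)
Definition rstar (f : ratfun) : ratfun :=
  (map_poly (fun c => rconst c^*) (rnum f)).[rvar^-1] /
  (map_poly (fun c => rconst c^*) (rden f)).[rvar^-1].

End RationalFunctions.

Section ORF.
Variable R : realType.
Local Notation C := R[i].
Local Notation ratfun := (ratfun R).
Local Notation borelC := (borelC R).
Variable alpha : nat -> C.

Definition varpi n : ratfun := 1 - rconst (alpha n)^* * rvar R.
Definition varpi_star n : ratfun := rvar R - rconst (alpha n).
Definition zeta n : ratfun := varpi_star n / varpi n.
Definition pi_prod n : ratfun := \prod_(1 <= k < n.+1) varpi k.
Definition Blaschke n : ratfun := \prod_(1 <= k < n.+1) zeta k.
Definition Blaschke_even n : ratfun := \prod_(1 <= k < n.+1) zeta (2 * k).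

(* phi_n^* = B_n phi_{n*}, for a sequence phi *)
Definition superstar (phi : nat -> ratfun) n : ratfun :=
  Blaschke n * rstar (phi n).

(* varpi_n(alpha_n) = 1 - |alpha_n|^2 *)
Definition enorm (a : nat -> C) n : C :=
  sqrtC ((reval (varpi n) (alpha n) / reval (varpi n.-1) (alpha n.-1)) *
         (1 - `|a n| ^+ 2)^-1).

Definition in_span (F : nat -> ratfun) n (f : ratfun) : Prop :=
  exists c : nat -> C, f = \sum_(0 <= k < n) rconst (c k) * F k.

(* [phi] is the sequence of orthogonal rational functions of [mu] for [alpha],
   and [a = S_alpha(mu)] its sequence of parameters; [a 0] is irrelevant. *)
Definition is_ORF (mu : {measure set borelC -> \bar R})
    (phi : nat -> ratfun) (a : nat -> C) : Prop :=
  [/\ forall n, orthonormal mu (fun k : 'I_n => reval (phi k)),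
      forall n f, in_span phi n.+1 f <-> in_span Blaschke n.+1 f,
      phi 0%N = 1 &
      forall n, (0 < n)%N ->
        [/\ `|a n| < 1,
            phi n = rconst (enorm a n) * (varpi n.-1 / varpi n) *
              (zeta n.-1 * phi n.-1 + rconst (a n) * superstar phi n.-1) &
            superstar phi n = rconst (enorm a n) * (varpi n.-1 / varpi n) *
              (rconst (a n)^* * (zeta n.-1 * phi n.-1)
               + superstar phi n.-1)]].

(* ORF for the sequence (alpha_1, 1/conj alpha_2, alpha_3, ...):
   chi_{2m} = B^e_{m*} phi_{2m}^*, chi_{2m+1} = B^e_{m*} phi_{2m+1}. *)
Definition chi (phi : nat -> ratfun) k : ratfun :=
  rstar (Blaschke_even k./2) * (if odd k then phi k else superstar phi k).

Definition para (phi : nat -> ratfun) n (v : C) : ratfun :=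
  phi n + rconst v * superstar phi n.

Definition christoffel (phi : nat -> ratfun) n (z : C) : R :=
  (\sum_(k < n) normsq (reval (phi k) z))^-1.

Lemma christoffel_ge0 (phi : nat -> ratfun) n z : 0 <= christoffel phi n z.
Proof.
by rewrite invr_ge0 sumr_ge0 // => k _; rewrite addr_ge0 // sqr_ge0.
Qed.

Definition para_zeros (phi : nat -> ratfun) n (v : C) : seq C :=
  finmap.enum_fset (fset_set [set z : C | rzero (para phi n v) z]).

(* mu_n^v: sum over the zeros l of Q_n^v of the point masses
   (sum_{k<n} |phi_k(l)|^2)^-1 at l. *)
Definition para_measure (phi : nat -> ratfun) n (v : C)
    : {measure set borelC -> \bar R} :=
  msum (fun i =>
    mscale (NngNum (christoffel_ge0 phi n (para_zeros phi n v)`_i))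
           (dirac ((para_zeros phi n v)`_i : borelC)))
    (size (para_zeros phi n v)).

End ORF.

Section Matrices.
Variable R : realType.
Local Notation C := R[i].

Definition mx2 (x y z t : C) : 'M[C]_2 :=
  \matrix_(i, j) if i == 0 then (if j == 0 then x else y)
                 else (if j == 0 then z else t).

Definition Theta (a : nat -> C) n : 'M[C]_2 :=
  let rho := sqrtC (1 - `|a n| ^+ 2) in mx2 (- a n) rho rho (a n)^*.

(* Infinite matrices are functions nat -> nat -> C, indices starting at 0. *)
Definition dsum2 (B : nat -> 'M[C]_2) (i j : nat) : C :=
  if i./2 == j./2 then B i./2 (inord (odd i)) (inord (odd j)) else 0.

Definition CMV_o (a : nat -> C) : nat -> nat -> C :=
  dsum2 (fun m => Theta a (2 * m + 1)).

Definition CMV_e (a : nat -> C) (i j : nat) : C :=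
  match i, j with
  | 0%N, 0%N => 1
  | i'.+1, j'.+1 => dsum2 (fun m => Theta a (2 * m + 2)) i' j'
  | _, _ => 0
  end.

(* Row i of [CMV_o] vanishes beyond column i + 1. *)
Definition CMV (a : nat -> C) (i j : nat) : C :=
  \sum_(k < i.+2) CMV_o a i k * CMV_e a k j.

Definition principal (M : nat -> nat -> C) n : 'M[C]_n :=
  \matrix_(i < n, j < n) M i j.

(* C_n^u: the principal submatrix C_n with a_n replaced by u. *)
Definition CMV_u (a : nat -> C) n (u : C) : 'M[C]_n :=
  principal (CMV (fun k => if k == n then u else a k)) n.

Definition Amx (alpha : nat -> C) (i j : nat) : C :=
  if i == j then alpha i else 0.

(* Square root of a positive semidefinite matrix, by diagonalization in an
   orthonormal basis; it does not depend on the chosen diagonalization. *)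
Definition sqrtmx n (M : 'M[C]_n) : 'M[C]_n :=
  invmx (spectralmx M) *m diag_mx (map_mx (fun x => sqrtC x) (spectral_diag M))
    *m spectralmx M.

Definition eta n (A : 'M[C]_n) : 'M[C]_n := sqrtmx (1%:M - A *m A ^t*).

Definition op_mobius n (A T : 'M[C]_n) : 'M[C]_n :=
  invmx (eta A) *m (T + A) *m invmx (1%:M + A ^t* *m T) *m eta (A ^t*).

End Matrices.

(* Main.v *)
Require Import Defs.
From HB Require Import structures.
From mathcomp Require Import all_boot all_order all_algebra.
From mathcomp Require Import generic_quotient spectral complex.
From mathcomp Require Import all_classical all_reals all_analysis.
From mathcomp Require Import measurable_realfun.
From mathcomp Require Import ring lra zify.

(** For [|z| = 1] put [eta_k = sqrt (1 - |alpha_k|^2)] and let [X_k] and [Y_k] be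
[chi_k(z) / eta_k] times [varpi_k(z)] and [varpi_k^*(z)]. The recurrence of the
ORF, read blockwise, says that [Y = X C] for the infinite matrix [C = C_o C_e].
Since [|u| = 1] decouples the block of index [n], the relation truncates to
[Y = X C_n^u] exactly when [H + u G = 0], where [H] and [G] are the multiples of
[zeta_{n-1} phi_{n-1}] and [phi_{n-1}^*] occurring in the last step, and this is
[Q_n^v(z) = 0]. On the other hand [Y = X C_n^u] is [chi(z) U = z chi(z)] with the
denominator of the operator Moebius transformation cleared.

Conversely [X] can be computed from [X_0] by means of the recurrence, so that an
eigenvector of [U] at [l] is a multiple of [chi(l)], and [l] is a zero of [Q_n^v].
As [U] is unitary, it has [n] distinct unimodular eigenvalues, which exhaust the
zeros of the numerator of [Q_n^v]. The normalised rows [chi(l)] form a unitary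
matrix; its orthogonality relations are those of the quadrature formula because
[|chi_k| = |phi_k|] on the circle. *)

Set Implicit Arguments.
Unset Strict Implicit.
Unset Printing Implicit Defensive.

Import Order.TTheory GRing.Theory Num.Theory.
Import numFieldNormedType.Exports.

Local Open Scope ring_scope.
Local Open Scope sesquilinear_scope.

(** * CMV matrices *)

Section PairMatrices.
Variable R : realType.
Local Notation C := R[i].

(* Entry of a direct sum of blocks of order at most 2, the involution [p]
   exchanging the two indices of a block. *)
Definition pair_entry (p : nat -> nat) (d r : nat -> C) (i j : nat) : C :=
  (j == i)%:R * d j + (p j == i)%:R * r j.

Lemma pair_entry0 (p : nat -> nat) (d r : nat -> C) i j :
  j != i -> p j != i -> pair_entry p d r i j = 0.
Proof.
by move=> /negbTE ji /negbTE pji; rewrite /pair_entry ji pji !mul0r addr0.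
Qed.

Lemma pair_entryC (p : nat -> nat) (d r : nat -> C) : involutive p -> (forall j, r (p
  j) = r j) ->
  forall i j, pair_entry p d r i j = pair_entry p d r j i.
Proof.
move=> pK rp i j; rewrite /pair_entry; congr (_ + _).
  by rewrite eq_sym; case: eqP => [->|]; rewrite ?mul0r.
rewrite -(inj_eq (inv_inj pK)) pK eq_sym.
by case: eqP => [<-|]; rewrite ?mul0r // rp.
Qed.

(** Column [j] is supported on the rows [j] and [p j]. If truncation removes row [p j], the entry
    lost is [r j], which the hypothesis makes zero. *)
Lemma sum_pair_entry n (p : nat -> nat) (d r : nat -> C) (X : nat -> C) (j : 'I_n) :
  ((n <= p j)%N -> r j = 0) ->
  \sum_(i < n) X i * pair_entry p d r i j = d j * X j + r j * X (p j).
Proof.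
move=> r0; under eq_bigr do rewrite mulrDr; rewrite big_split /=; congr (_ + _).
  rewrite (bigD1 j) //= eqxx mul1r big1 ?addr0 1?mulrC // => i.
  by rewrite eq_sym -val_eqE /= => /negbTE->; rewrite mul0r mulr0.
have [/r0 ->|pj] := leqP n (p j); first by rewrite mul0r big1 // => i; rewrite !mulr0.
rewrite (bigD1 (Ordinal pj)) //= eqxx mul1r big1 ?addr0 1?mulrC // => i.
by rewrite eq_sym -val_eqE /= => /negbTE->; rewrite mul0r mulr0.
Qed.

(** The product of row [i] with the adjoint of row [j] has a contribution only when [j] is [i] or
    [p i]. The last two conditions say that these are 1 and 0; the first says that truncation cuts
    no block. *)
Lemma pair_entry_unitary n (p : nat -> nat) (d r : nat -> C) : involutive p -> (forall
  j, r (p j) = r j) ->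
  (forall j, (j < n)%N -> [/\ (n <= p j)%N -> r j = 0, (r j)^* = r j,
    d j * (d j)^* + r j ^+ 2 = 1 & r j * (d j + (d (p j))^*) = 0]) ->
  principal (pair_entry p d r) n \is unitarymx.
Proof.
move=> pK rp H; apply/unitarymxP/matrixP => i j; rewrite !mxE.
have [r0 rR dr rd] := H i (ltn_ord i).
pose X k := (pair_entry p d r j k)^*.
rewrite (eq_bigr (fun k : 'I_n => X k * pair_entry p d r k i)); last first.
  by move=> k _; rewrite !mxE mulrC (pair_entryC _ pK rp i).
have XE k : X k = (k == j)%:R * (d k)^* + (p k == j)%:R * (r k)^*.
  by rewrite /X /pair_entry rmorphD /= !rmorphM /= !rmorph_nat.
rewrite (@sum_pair_entry _ p d r X _ r0) !XE pK rp rR.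
have -> : (i == j :> nat) = (i == j) by [].
transitivity ((i == j)%:R * (d i * (d i)^* + r i ^+ 2)
   + (p i == j)%:R * (r i * (d i + (d (p i))^*))); first by ring.
by rewrite dr rd mulr1 mulr0 addr0.
Qed.

End PairMatrices.

(** * The two CMV factors and their truncation *)

Section CMVMatrices.
Variable R : realType.
Local Notation C := R[i].
Variable a : nat -> C.

Local Notation rho k := (sqrtC (1 - `|a k| ^+ 2)).

(** Indices start at 0, so [Theta a (2 * m + 1)] occupies the indices 2m and 2m+1, and
    [Theta a (2 * m + 2)] the indices 2m+1 and 2m+2. In both factors the parameter of a block is
    numbered by the greater index of the block. *)
Definition odd_mate (j : nat) := if odd j then j.-1 else j.+1.
Definition CMV_o_diag (j : nat) : C := if odd j then (a j)^* else - a j.+1.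
Definition CMV_o_off (j : nat) : C := if odd j then rho j else rho j.+1.

Definition even_mate (j : nat) := if j is j'.+1 then (odd_mate j').+1 else 0%N.
Definition CMV_e_diag (j : nat) : C :=
  if j == 0%N then 1 else if odd j then - a j.+1 else (a j)^*.
(** Index 0 is its own mate; the value 0 keeps [pair_entry] from adding an off-diagonal term to the
    block of order 1. *)
Definition CMV_e_off (j : nat) : C :=
  if j == 0%N then 0 else if odd j then rho j.+1 else rho j.

Lemma odd_mateK : involutive odd_mate.
Proof.
move=> j; rewrite /odd_mate; case: (boolP (odd j)) => [oj|/= oj]; last by rewrite oj.
by rewrite (_ : odd j.-1 = false); lia.
Qed.

Lemma even_mateK : involutive even_mate.
Proof. by case=> //= j; rewrite odd_mateK. Qed.

Lemma CMV_o_off_mate j : CMV_o_off (odd_mate j) = CMV_o_off j.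
Proof.
rewrite /CMV_o_off /odd_mate; case oj: (odd j); case: ifP => oj'; first [congr (rho _);
  lia|by []].
Qed.

Lemma CMV_e_off_mate j : CMV_e_off (even_mate j) = CMV_e_off j.
Proof.
case: j => //= j; rewrite /CMV_e_off /odd_mate /=; case oj: (odd j) => /=; rewrite ?oj //.
by case: ifP => oj'; [congr (rho _); lia|move: oj'; lia].
Qed.

Lemma CMV_oE i j : CMV_o a i j = pair_entry odd_mate CMV_o_diag CMV_o_off i j.
Proof.
rewrite /CMV_o /dsum2 /pair_entry /odd_mate /CMV_o_diag /CMV_o_off.
have [<-|ne] := eqVneq j i.
  rewrite eqxx mul1r /Theta mxE /=; case oj: (odd j).
    rewrite -val_eqE /= inordK //= (_ : _ == _ = false) ?mul0r ?addr0; last lia.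
    by congr (_ (a _)); lia.
  rewrite -val_eqE /= inordK //= (_ : _ == _ = false) ?mul0r ?addr0; last lia.
  by congr (- a _); lia.
rewrite mul0r add0r; case: eqP => [e|ne2]; last first.
  rewrite (_ : (_ == i) = false) ?mul0r //.
  by case: ifP => oj; apply/eqP; move: ne ne2 => /eqP; lia.
have -> : odd i = ~~ odd j by move/eqP: ne; lia.
rewrite /Theta mxE /= -!val_eqE /=; case oj: (odd j) => /=; rewrite !inordK //=.
  by rewrite (_ : _ == i) ?mul1r; [congr (sqrtC (1 - `|a _| ^+ 2))|]; lia.
by rewrite (_ : _ == i) ?mul1r; [congr (sqrtC (1 - `|a _| ^+ 2))|]; move: ne; lia.
Qed.

Lemma CMV_eE i j : CMV_e a i j = pair_entry even_mate CMV_e_diag CMV_e_off i j.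
Proof.
case: i j => [|i] [|j]; rewrite /pair_entry /= ?mul1r ?mulr0 ?addr0 ?mul0r ?addr0 //.
rewrite /dsum2 /CMV_e_diag /CMV_e_off /odd_mate !eqSS /=.
have [<-|ne] := eqVneq j i.
  rewrite eqxx mul1r /Theta mxE /=; case oj: (odd j) => /=.
    rewrite -val_eqE /= inordK //= (_ : _ == _ = false) ?mul0r ?addr0; last lia.
    by congr (_ (a _)); lia.
  rewrite -val_eqE /= inordK //= (_ : _ == _ = false) ?mul0r ?addr0; last lia.
  by congr (- a _); lia.
rewrite mul0r add0r; case: eqP => [e|ne2]; last first.
  rewrite (_ : (_ == i) = false) ?mul0r //.
  by case: ifP => oj; apply/eqP; move: ne ne2 => /eqP; lia.
have -> : odd i = ~~ odd j by move/eqP: ne; lia.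
rewrite /Theta mxE /= -!val_eqE /=; case oj: (odd j) => /=; rewrite !inordK //=.
  by rewrite (_ : _ == i) ?mul1r; [congr (sqrtC (1 - `|a _| ^+ 2))|]; lia.
by rewrite (_ : _ == i) ?mul1r; [congr (sqrtC (1 - `|a _| ^+ 2))|]; move: ne; lia.
Qed.

Lemma sum_ord_support (V : nmodType) (F : nat -> V) m N :
  (m <= N)%N -> (forall k, (m <= k)%N -> (k < N)%N -> F k = 0) ->
  \sum_(k < m) F k = \sum_(k < N) F k.
Proof.
move=> mN F0; rewrite (big_ord_widen _ F mN) [RHS](bigID (fun k : 'I_N => (k < m)%N)) /=.
by rewrite [X in _ + X]big1 ?addr0 // => k; rewrite -leqNgt => km; rewrite F0.
Qed.

Variable n : nat.
Hypothesis n_gt0 : (0 < n)%N.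
Hypothesis an1 : `|a n| = 1.

Lemma rho_last : rho n = 0.
Proof. by rewrite an1 expr1n subrr sqrtC0. Qed.

Lemma CMV_o_off_last j : (j < n)%N -> (n <= odd_mate j)%N -> CMV_o_off j = 0.
Proof.
rewrite /odd_mate /CMV_o_off; case: ifP => oj jn nj; first lia.
by rewrite -rho_last; congr (rho _); lia.
Qed.

Lemma CMV_e_off_last j : (j < n)%N -> (n <= even_mate j)%N -> CMV_e_off j = 0.
Proof.
case: j => [|j]; first by rewrite /CMV_e_off.
rewrite /even_mate /odd_mate /CMV_e_off /=; case: ifP => oj jn nj; first lia.
by rewrite -rho_last /=; congr (rho _); lia.
Qed.

(** Truncation does not commute with products in general. Here an index [k >= n] is linked to an
    index below [n] only through an entry rho_n, and rho_n = 0 because |a_n| = 1. *)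
Lemma CMV_principal : principal (CMV a) n =
  principal (pair_entry odd_mate CMV_o_diag CMV_o_off) n *m principal (pair_entry
    even_mate CMV_e_diag CMV_e_off) n.
Proof.
apply/matrixP => i j; rewrite !mxE /CMV.
under eq_bigr do rewrite CMV_oE CMV_eE.
under [RHS]eq_bigr do rewrite !mxE.
pose F k := pair_entry odd_mate CMV_o_diag CMV_o_off i k * pair_entry even_mate
  CMV_e_diag CMV_e_off k j.
(* The sum defining [CMV] has i + 2 terms and the matrix product has n; both are extended to n + i +
   2 terms. *)
rewrite (@sum_ord_support _ F i.+2 (n + i.+2)) ?leq_addl //; last first.
  move=> k ik _; rewrite /F pair_entry0 ?mul0r //; first lia.
  by rewrite /odd_mate; case: ifP => ok; lia.
rewrite -(@sum_ord_support _ F n) ?leq_addr // => k nk _.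
have ki : k != i by have := ltn_ord i; lia.
have [e|ne] := eqVneq (odd_mate k) i; last by rewrite /F pair_entry0 ?mul0r.
rewrite /F /pair_entry (negbTE ki) mul0r add0r -CMV_o_off_mate e CMV_o_off_last ?mulr0
  ?mul0r //.
by rewrite -e odd_mateK.
Qed.

Hypothesis a1 : forall k, (0 < k < n)%N -> `|a k| < 1.

Lemma rho_real k : (0 < k <= n)%N -> (rho k)^* = rho k.
Proof.
move=> kn; apply/CrealP/ger0_real; rewrite sqrtC_ge0 subr_ge0 exprn_ile1 //.
move: kn; case/andP=> k0; rewrite leq_eqVlt => /orP[/eqP->|kn]; first by rewrite an1.
by apply/ltW/a1; rewrite k0.
Qed.

Lemma normsq_rho k : a k * (a k)^* + rho k ^+ 2 = 1.
Proof. by rewrite -normCK sqrtCK subrKC. Qed.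

Lemma CMV_o_unitary : principal (pair_entry odd_mate CMV_o_diag CMV_o_off) n \is
  unitarymx.
Proof.
apply: pair_entry_unitary; [exact: odd_mateK|exact: CMV_o_off_mate|] => j jn; split.
- exact: CMV_o_off_last.
- by rewrite /CMV_o_off; case: ifP => oj; apply: rho_real; lia.
- rewrite /CMV_o_diag /CMV_o_off; case: ifP => _; rewrite ?rmorphN ?mulrNN ?conjCK;
  last exact: normsq_rho.
  by rewrite mulrC normsq_rho.
- rewrite /CMV_o_diag /CMV_o_off /odd_mate; case oj: (odd j) => /=.
    have -> : odd j.-1 = false by lia.
    by rewrite rmorphN prednK ?subrr ?mulr0 //; lia.
  by rewrite oj /= conjCK addNr mulr0.
Qed.

Lemma CMV_e_unitary : principal (pair_entry even_mate CMV_e_diag CMV_e_off) n \is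
  unitarymx.
Proof.
apply: pair_entry_unitary; [exact: even_mateK|exact: CMV_e_off_mate|] => j jn; split.
- exact: CMV_e_off_last.
- rewrite /CMV_e_off; case: eqP => j0; first by rewrite rmorph0.
  by case: ifP => oj; apply: rho_real; lia.
- rewrite /CMV_e_diag /CMV_e_off; case: eqP => _; first by rewrite rmorph1 expr0n addr0
  mulr1.
  case: ifP => _; rewrite ?rmorphN ?mulrNN ?conjCK; first exact: normsq_rho.
  by rewrite mulrC normsq_rho.
- case: j jn => [|j] jn; first by rewrite /CMV_e_off eqxx mul0r.
  rewrite /CMV_e_diag /CMV_e_off /even_mate /odd_mate /=; case oj: (odd j) => /=.
    have -> /= : odd j.-1 = false by lia.
    by rewrite rmorphN prednK ?subrr ?mulr0 //; lia.
  by rewrite oj /= conjCK addNr mulr0.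
Qed.

Lemma CMV_unitary : principal (CMV a) n \is unitarymx.
Proof. by rewrite CMV_principal mul_unitarymx ?CMV_o_unitary ?CMV_e_unitary. Qed.

End CMVMatrices.

(** * Operator Moebius transformations *)

Section OperatorMobius.
Variable R : realType.
Local Notation C := R[i].

Lemma addr_swap_eq (V : zmodType) (x y z t : V) :
  x + y = z + t <-> z - y = x - t.
Proof.
split=> [/(canRL (addrK y)) ->|/(canRL (subrK y)) ->]; first by rewrite addrAC addrK.
by rewrite addrAC subrK.
Qed.

Lemma adjmxM (F : numClosedFieldType) m n p (A : 'M[F]_(m, n)) (B : 'M[F]_(n, p)) :
  (A *m B) ^t* = B ^t* *m A ^t*.
Proof. by rewrite trmx_mul map_mxM. Qed.

Lemma adjmxB (F : numClosedFieldType) m n (A B : 'M[F]_(m, n)) :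
  (A - B) ^t* = A ^t* - B ^t*.
Proof. by rewrite linearB /= map_mxB. Qed.

Lemma addr_swap_eq4 (V : zmodType) (x z p q b t : V) :
  p - q - (b - x) = z - b - (q - t) -> t - p = x - z.
Proof.
have -> : p - q - (b - x) = p + x + (- q - b) by rewrite opprB addrACA.
have -> : z - b - (q - t) = z + t + (- q - b).
  by rewrite opprB addrACA [- b - q]addrC.
by move/addIr; rewrite addrC [z + t]addrC => /addr_swap_eq.
Qed.

(* The hypothesis rearranges to [(W A^* - X) T = X A - W]; compare the products
   of both sides with their adjoints. *)
Lemma cayley_isometry (F : numClosedFieldType) n (W X A T : 'M[F]_n) :
  T \is unitarymx -> W *m (1%:M + A ^t* *m T) = X *m (T + A) ->
  W *m (1%:M - A ^t* *m A) *m W ^t* = X *m (1%:M - A *m A ^t*) *m X ^t*.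
Proof.
move=> Tu WE; have {WE} : (W *m A ^t* - X) *m T = X *m A - W.
  move: WE; rewrite !mulmxDr mulmx1 mulmxA [W + _]addrC [X *m T + _]addrC =>
    /esym/addr_swap_eq.
  by rewrite -mulmxBl.
move=> WE.
have : (W *m A ^t* - X) *m (W *m A ^t* - X) ^t* = (X *m A - W) *m (X *m A - W) ^t*.
  by rewrite -WE adjmxM mulmxA mulmxtVK.
rewrite !adjmxB !adjmxM trmxCK !mulmxBr !mulmxBl !mulmx1 !mulmxA.
exact: addr_swap_eq4.
Qed.

(** The diagonalizing basis P of a diagonal matrix need not be the standard one. But P diag(d) =
    diag(s) P means that P i j vanishes unless s i = d j, so P intertwines the square roots as
    well. *)
Lemma sqrtmx_diag n (d : 'rV[C]_n) :
  sqrtmx (diag_mx d) = diag_mx (map_mx (fun x => sqrtC x) d).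
Proof.
rewrite /sqrtmx; set P := spectralmx _; set s := spectral_diag _.
have /orthomx_spectralP E : diag_mx d \is normalmx.
  by apply/normalmxP; rewrite tr_diag_mx map_diag_mx diag_mxC.
have Pu : P \in unitmx := spectral_unit _.
have {}E : P *m diag_mx d = diag_mx s *m P by rewrite E -!mulmxA mulKVmx.
rewrite -mulmxA; apply: (canLR (mulKmx Pu)).
apply/matrixP => i j; move/matrixP/(_ i j): E.
rewrite !mul_mx_diag !mul_diag_mx !mxE => /eqP.
have [->|P0] := eqVneq (P i j) 0; first by rewrite !mul0r !mulr0.
by rewrite mulrC => /eqP/(mulIf P0) ->; rewrite mulrC.
Qed.

Lemma mul_row_conj n (x : 'rV[C]_n) : (x *m x ^t*) 0 0 = \sum_i `|x 0 i| ^+ 2.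
Proof. by rewrite mxE; apply: eq_bigr => i _; rewrite !mxE normCK. Qed.

Variables (alpha : nat -> C) (n : nat) (T : 'M[C]_n).
Hypothesis alpha1 : forall k, (k < n)%N -> `|alpha k| < 1.
Hypothesis Tu : T \is unitarymx.

Local Notation A := (principal (Amx alpha) n).
Local Notation e k := (sqrtC (1 - `|alpha k| ^+ 2)).
Local Notation N := (diag_mx (\row_(k < n) e k)).
Local Notation N' := (diag_mx (\row_(k < n) (e k)^-1)).

Lemma eta_gt0 k : (k < n)%N -> 0 < e k.
Proof. by move=> kn; rewrite sqrtC_gt0 subr_gt0 expr_lt1 ?alpha1. Qed.

Lemma eta_conj k : (k < n)%N -> (e k)^* = e k.
Proof. by move=> kn; apply/CrealP/gtr0_real/eta_gt0. Qed.

Lemma Amx_diag : A = diag_mx (\row_(k < n) alpha k).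
Proof.
apply/matrixP => i j; rewrite !mxE /Amx -val_eqE.
by case: eqP => _; rewrite ?mulr1n.
Qed.

Lemma Amx_adj : A ^t* = diag_mx (\row_(k < n) (alpha k)^*).
Proof.
rewrite Amx_diag tr_diag_mx map_diag_mx; congr diag_mx.
by apply/rowP => k; rewrite !mxE.
Qed.

Lemma one_sub_AmxC :
  1%:M - A ^t* *m A = diag_mx (\row_(k < n) (1 - `|alpha k| ^+ 2)).
Proof.
apply/matrixP => i j; rewrite Amx_adj Amx_diag mul_diag_mx !mxE.
by rewrite normCKC; case: eqP => _; rewrite ?mulr1n // mulr0 subrr.
Qed.

Lemma one_sub_Amx :
  1%:M - A *m A ^t* = diag_mx (\row_(k < n) (1 - `|alpha k| ^+ 2)).
Proof. by rewrite -one_sub_AmxC Amx_adj Amx_diag diag_mxC. Qed.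

Lemma eta_Amx : Defs.eta A = N.
Proof.
rewrite /Defs.eta one_sub_Amx sqrtmx_diag; congr diag_mx.
by apply/rowP => k; rewrite !mxE.
Qed.

Lemma eta_AmxC : Defs.eta (A ^t*) = N.
Proof.
rewrite /Defs.eta trmxCK one_sub_AmxC sqrtmx_diag; congr diag_mx.
by apply/rowP => k; rewrite !mxE.
Qed.

Lemma mul_eta_inv : N *m N' = 1%:M.
Proof.
rewrite mulmx_diag; apply/matrixP => i j; rewrite !mxE divff //.
by rewrite gt_eqF // eta_gt0.
Qed.

Lemma eta_unit : N \in unitmx.
Proof. by have /mulmx1_unit[] := mul_eta_inv. Qed.

Lemma eta_inv : invmx N = N'.
Proof. by rewrite -[RHS](mulKmx eta_unit) mul_eta_inv mulmx1. Qed.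

(** If x = - x A^t* T, then, T preserving norms, the sum of |x_k|^2 (1 - |alpha_k|^2) vanishes; all
    its terms are nonnegative, hence x = 0. *)
Lemma one_add_Amx_unit : 1%:M + A ^t* *m T \in unitmx.
Proof.
rewrite -row_free_unit -kermx_eq0; apply/eqP/row_matrixP => i.
rewrite row0.
have : row i (kermx (1%:M + A ^t* *m T)) *m (1%:M + A ^t* *m T) = 0.
  by apply/sub_kermxP; exact: row_sub.
move: (row _ _) => x.
rewrite mulmxDr mulmx1 mulmxA => /eqP; rewrite addr_eq0 => /eqP xE.
have : (x *m x ^t*) 0 0 = ((x *m A ^t*) *m (x *m A ^t*) ^t*) 0 0.
  rewrite {1 2}xE linearN /= map_mxN mulmxN mulNmx opprK trmx_mul map_mxM mulmxA.
  by rewrite mulmxtVK.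
rewrite !mul_row_conj => /eqP; rewrite -subr_eq0 -sumrB => /eqP.
under eq_bigr do rewrite Amx_adj mul_mx_diag !mxE normrM exprMn norm_conjC
  -{1}[_ ^+ 2]mulr1 -mulrBr.
have ge0 k (_ : true) : 0 <= `|x 0 k| ^+ 2 * (1 - `|alpha k| ^+ 2).
  by rewrite mulr_ge0 // ?exprn_ge0 // ltW // subr_gt0 expr_lt1 ?alpha1.
move/psumr_eq0P => /(_ ge0) H; apply/rowP => k; rewrite [RHS]mxE.
have /eqP := H k isT.
rewrite mulf_eq0 expf_eq0 /= normr_eq0 [X in _ || X]gt_eqF ?orbF.
  by move=> /eqP.
by rewrite subr_gt0 expr_lt1 ?alpha1.
Qed.

Local Notation U := (op_mobius A T).

(** Put w = x N^-1. Clearing the inverse turns the eigenvalue equation into w (T + A) = l w (1 +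
    A^t* T); collecting the terms that contain T gives the entrywise relation. *)
Lemma op_mobius_eigen (x : 'rV[C]_n) l : x *m U = l *: x <->
  forall j : 'I_n, x 0 j / e j * (l - alpha j) =
   ((\row_k (x 0 k / e k * (1 - l * (alpha k)^*))) *m T) 0 j.
Proof.
rewrite /op_mobius eta_Amx eta_AmxC eta_inv.
pose w := x *m N'.
have -> : \row_k (x 0 k / e k * (1 - l * (alpha k)^*)) = w - l *: (w *m A ^t*).
  apply/rowP => k; rewrite Amx_adj /w !mul_mx_diag !mxE.
  by rewrite mulrBr mulr1 mulrCA.
transitivity (w *m (T + A) = l *: (w *m (1%:M + A ^t* *m T))).
  rewrite !mulmxA -/w; split.
    move/(congr1 (mulmx^~ N')); rewrite -!mulmxA mul_eta_inv mulmx1 -scalemxAl -/w.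
    move/(congr1 (mulmx^~ (1%:M + A ^t* *m T))); rewrite -!mulmxA.
    by rewrite mulVmx ?one_add_Amx_unit // mulmx1 => ->; rewrite /w -!scalemxAl !mulmxA.
  move=> ->; rewrite scalemxAl mulmxK ?one_add_Amx_unit // -scalemxAl /w -mulmxA.
  by rewrite -eta_inv mulVmx ?eta_unit // mulmx1.
transitivity (l *: w - w *m A = (w - l *: (w *m A ^t*)) *m T).
  rewrite mulmxBl !mulmxDr mulmx1 scalerDr -scalemxAl mulmxA.
  exact: addr_swap_eq.
split => [/rowP H j|H]; last apply/rowP => j.
  by rewrite -H Amx_diag /w !mul_mx_diag !mxE mulrBr [l * _]mulrC.
by rewrite -H Amx_diag /w !mul_mx_diag !mxE mulrBr [l * _]mulrC.
Qed.

(** Write U = W N. The product of U with its adjoint is W N^2 W^t*, where N^2 = 1 - A^t* A, and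
    [cayley_isometry] with X = N^-1 turns this into N^-1 N^2 N^-1 = 1. *)
Lemma op_mobius_unitary : U \is unitarymx.
Proof.
rewrite /op_mobius eta_Amx eta_AmxC eta_inv.
set D := invmx _; set W := N' *m (T + A) *m D.
have NC : N ^t* = N.
  rewrite tr_diag_mx map_diag_mx; congr diag_mx; apply/rowP => k.
  by rewrite !mxE; apply: eta_conj.
have NC' : N' ^t* = N'.
  rewrite tr_diag_mx map_diag_mx; congr diag_mx; apply/rowP => k.
  by rewrite !mxE fmorphV /= eta_conj.
have NN : N *m N = 1%:M - A ^t* *m A.
  rewrite one_sub_AmxC mulmx_diag; congr diag_mx; apply/rowP => k.
  by rewrite !mxE -expr2 sqrtCK.
apply/unitarymxP; rewrite adjmxM NC mulmxA -(mulmxA W N) NN.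
rewrite (@cayley_isometry _ _ _ N' _ T) // ?one_sub_Amx -?one_sub_AmxC -?NN.
  by rewrite NC' mulmxA -(mulmxA _ N) mul_eta_inv mulmx1 -eta_inv mulVmx ?eta_unit.
by rewrite mulmxKV // one_add_Amx_unit.
Qed.

End OperatorMobius.

(** * Szego recurrence and truncated CMV matrices *)

Section SzegoRecurrence.
Variable R : realType.
Local Notation C := R[i].
Variables (a : nat -> C) (n : nat).
Hypothesis n_gt0 : (0 < n)%N.
Hypothesis an1 : `|a n| = 1.

Local Notation rho k := (sqrtC (1 - `|a k| ^+ 2)).

(* Entry [j] of the row [X C_o]. *)
Definition CMV_half (X : nat -> C) j := CMV_o_diag a j * X j + CMV_o_off a j * X
  (odd_mate j).

(** The sequence [X] may be arbitrary from index [n] on: such values occur only with a coefficient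
    rho_n = 0. *)
Lemma mul_CMV (x : 'rV[C]_n) (X : nat -> C) (j : 'I_n) :
  (forall i : 'I_n, x 0 i = X i) ->
  (x *m principal (CMV a) n) 0 j =
    CMV_e_diag a j * CMV_half X j + CMV_e_off a j * CMV_half X (even_mate j).
Proof.
move=> xX; rewrite CMV_principal // mulmxA mxE.
under eq_bigr => k _.
  rewrite !mxE; under eq_bigr => i _ do rewrite xX mxE.
  rewrite (@sum_pair_entry _ _ _ (CMV_o_diag a) (CMV_o_off a)); last exact:
    CMV_o_off_last.
  rewrite -/(CMV_half X k); over.
by rewrite (@sum_pair_entry _ _ _ (CMV_e_diag a) (CMV_e_off a)) //; apply: CMV_e_off_last.
Qed.

Variables (F G H zeta_at b : nat -> C).
Hypothesis ztF : forall k, zeta_at k * F k = H k.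
Hypothesis b_zt : forall m, zeta_at m.*2.+2 * b m.+1 = b m.
Hypothesis FG0 : F 0%N = G 0%N.

(* [szego_X] is the row [X] and [szego_T] the row [X C_o]. *)
Definition szego_X k := b k./2 * (if odd k then F k else G k).
Definition szego_T k := b k./2 * (if odd k then G k else H k).

Hypothesis stepG : forall k, (k.+1 < n)%N ->
  G k.+1 = rho k.+1 * G k + (a k.+1)^* * F k.+1.

(** * From the recurrence to the matrix relation *)

Section Sufficient.
(** The range includes k = n - 1, where the term with rho_n drops out: there the hypothesis reads
    H_{n-1} = - a_n G_{n-1}, the condition for a zero of the para-orthogonal function. *)
Hypothesis stepH : forall k, (k < n)%N -> H k = - a k.+1 * G k + rho k.+1 * F k.+1.

(** The indices 2m and 2m+1 of a block of C_o share the factor b_m, so the block acts on the pair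
    G_{2m}, F_{2m+1} exactly as the recurrence does. *)
Lemma CMV_half_szego k : (k < n)%N -> CMV_half szego_X k = szego_T k.
Proof.
move=> kn; rewrite /CMV_half /szego_X /szego_T /CMV_o_diag /CMV_o_off /odd_mate.
case ok: (odd k) => /=.
  case: k ok kn => // k /= ok kn; rewrite (negbTE ok) stepG //.
  by rewrite uphalf_half (negbTE ok) add0n; ring.
by rewrite ok /= uphalf_half ok add0n stepH //; ring.
Qed.

(** The indices 2m+1 and 2m+2 of a block of C_e carry the different factors b_m and b_{m+1}; [b_zt]
    absorbs zeta_{2m+2} and makes them agree. *)
Lemma szego_eigen k : (k < n)%N -> zeta_at k * szego_X k =
  CMV_e_diag a k * CMV_half szego_X k + CMV_e_off a k * CMV_half szego_X (even_mate k).
Proof.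
case: k => [|k] kn.
  by rewrite CMV_half_szego // /szego_X /szego_T /CMV_e_diag /CMV_e_off /= -FG0 -ztF;
    ring.
rewrite CMV_half_szego //; case ok: (odd k).
  rewrite CMV_half_szego; last by rewrite /= /odd_mate ok; lia.
  case: k ok kn => // k /= ok kn.
  rewrite /szego_X /szego_T /CMV_e_diag /CMV_e_off /even_mate /odd_mate /= ok /= -ztF.
  have e : k.+2 = (k./2).*2.+2 by rewrite -[in LHS](odd_double_half k); move: ok; lia.
  have -> : uphalf k = k./2 by rewrite uphalf_half; move: ok; lia.
  rewrite stepG // ok; move: (b_zt k./2); rewrite -e => <-; ring.
(* When the partner index k + 2 equals n, [CMV_half_szego] does not apply to it, but its coefficient
   is rho_n = 0. *)
have [kn'|nk] := ltnP k.+2 n.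
  rewrite CMV_half_szego; last by rewrite /= /odd_mate ok.
  rewrite /szego_X /szego_T /CMV_e_diag /CMV_e_off /even_mate /odd_mate /= ok /= ok /=.
  have e : k.+2 = (k./2).*2.+2 by rewrite -[in LHS](odd_double_half k); move: ok; lia.
  have -> : uphalf k = k./2 by rewrite uphalf_half; move: ok; lia.
  rewrite [LHS]mulrCA ztF stepH // -ztF.
  by move: (b_zt k./2); rewrite -e => <-; ring.
have e : k.+2 = n by lia.
rewrite /szego_X /szego_T /CMV_e_diag /CMV_e_off /even_mate /odd_mate /= ok /= e
  (rho_last an1) mul0r addr0.
by rewrite mulrCA ztF stepH // e (rho_last an1); ring.
Qed.

End Sufficient.

(** * From the matrix relation to the recurrence *)

Section Necessary.
Hypothesis stepH : forall k, (k.+1 < n)%N -> H k = - a k.+1 * G k + rho k.+1 * F k.+1.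
Hypothesis rho_neq0 : forall k, (k.+1 < n)%N -> rho k.+1 != 0.
Hypothesis zeta_at_neq0 : forall k, zeta_at k != 0.
Hypothesis G0 : G 0%N = 1.
Hypothesis b0 : b 0%N = 1.

Variable X : nat -> C.
Hypothesis Xeigen : forall k, (k < n)%N -> zeta_at k * X k =
  CMV_e_diag a k * CMV_half X k + CMV_e_off a k * CMV_half X (even_mate k).

(** The relation is solved index by index. From an even k, the block of C_o gives X_{k+1} and then
    the half product; from an odd k, the block of C_e gives first the half product at k + 1 and then
    X_{k+1}. Each step divides by some rho or zeta, which is nonzero. *)
Lemma szego_unique k : (k < n)%N ->
  X k = X 0%N * szego_X k /\ CMV_half X k = X 0%N * szego_T k.
Proof.
elim: k => [|k IH] kn.
  split; first by rewrite /szego_X b0 G0; ring.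
  have := Xeigen kn; rewrite /CMV_e_diag /CMV_e_off /= mul1r mul0r addr0 => <-.
  by rewrite /szego_T /= b0 -ztF FG0 G0; ring.
have [{}IH1 IH2] := IH (ltnW kn).
have r0 := rho_neq0 kn; have z0 := zeta_at_neq0 k.+1.
case ok: (odd k).
  have e : k.+1 = (k./2).*2.+2 by rewrite -[in LHS](odd_double_half k); move: ok; lia.
  have e2 : k.+1./2 = (k./2).+1 by move: ok; lia.
  have b_rec := b_zt k./2; rewrite -e in b_rec.
  case: k => // k in ok kn IH IH1 IH2 r0 z0 e e2 b_rec *.
  move: (ok) => /= /negbTE ok'.
  have {e2} hk : uphalf k = k./2 by rewrite uphalf_half ok'.
  rewrite /= hk in b_rec.
  have XE : X k.+1 = X 0%N * (b k./2 * F k.+1) by rewrite IH1 /szego_X ok /= hk.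
  have TE : CMV_half X k.+1 = X 0%N * (b k./2 * G k.+1) by rewrite IH2 /szego_T ok /= hk.
  have := Xeigen (ltnW kn); rewrite /CMV_e_diag /CMV_e_off /even_mate /odd_mate /= ok'
    /= XE TE => E1.
  have T1 : CMV_half X k.+2 = X 0%N * (b k./2.+1 * H k.+2).
    apply: (mulfI r0); move/esym/(canRL (addKr _)): E1 => ->.
    rewrite -ztF; transitivity (X 0%N * (zeta_at k.+2 * b k./2.+1) * (rho k.+2 * F k.+2)).
      have -> : zeta_at k.+1 * (X 0%N * (b k./2 * F k.+1)) = X 0%N * (b k./2 * H k.+1).
        by rewrite -ztF; ring.
      by rewrite b_rec (stepH kn); ring.
    by ring.
  rewrite /szego_X /szego_T /= ok' /=; split=> //; apply: (mulfI z0).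
  rewrite Xeigen // /CMV_e_diag /CMV_e_off /even_mate /odd_mate /= ?ok' /= ?ok' T1 TE
    (stepG kn) -ztF -b_rec.
  by ring.
have hk : uphalf k = k./2 by rewrite uphalf_half ok.
move: (IH2); rewrite {1}/CMV_half /CMV_o_diag /CMV_o_off /odd_mate ok IH1 /szego_X
  /szego_T ok => E1.
have X1 : X k.+1 = X 0%N * szego_X k.+1.
  apply: (mulfI r0); move/(canRL (addKr _)): E1 => ->.
  by rewrite /szego_X /= ok /= hk (stepH kn); ring.
split=> //; rewrite /CMV_half /CMV_o_diag /CMV_o_off /odd_mate /= ok /= X1 IH1.
by rewrite /szego_X /szego_T /= ok /= hk stepG //; ring.
Qed.

Hypothesis b_neq0 : forall m, b m != 0.

(** The equations below the last index already determine X up to a factor. Since rho_n = 0, the one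
    left over at n - 1 (from C_e if n - 1 is odd, from C_o if it is even) is a constraint, and it is
    the missing instance of the recurrence. *)
Lemma szego_end : X 0%N != 0 -> H n.-1 = - a n * G n.-1.
Proof.
case: n n_gt0 an1 szego_unique Xeigen => // k _ ak1 /(_ k (ltnSn k))[E1 E2] /(_ k
  (ltnSn k)).
move=> E3 X0 /=; have r0 := rho_last ak1.
have Xb0 : X 0%N * b k./2 != 0 by rewrite mulf_neq0.
apply: (mulfI Xb0); case ok: (odd k).
  case: k => // k in ak1 E1 E2 E3 r0 Xb0 ok *.
  move: E3; rewrite /CMV_e_diag /CMV_e_off /even_mate /odd_mate /=; move: (ok) => /=
    /negbTE ok'.
  rewrite ok' /= r0 mul0r addr0 E2 E1 /szego_T /szego_X ok -!ztF => E3.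
  transitivity (zeta_at k.+1 * (X 0%N * (b k.+1./2 * F k.+1))); first by ring.
  by rewrite E3; ring.
move: E2; rewrite {1}/CMV_half /CMV_o_diag /CMV_o_off /odd_mate ok E1 r0 mul0r addr0
  /szego_T /szego_X ok => E2.
transitivity (X 0%N * (b k./2 * H k)); first by ring.
by rewrite -E2; ring.
Qed.

End Necessary.
End SzegoRecurrence.

(** * Evaluation of rational functions *)

Section RationalEvaluation.
Variable R : realType.
Local Notation C := R[i].
Local Notation ratfun := (ratfun R).
Implicit Types (f g : ratfun) (p q : {poly C}) (z c : C).

Lemma frac_reprE f : f = (frac (repr f)).1%:F / (frac (repr f)).2%:F.
Proof.
set x := repr f; have dx := denom_ratioP x.
have {1}-> : f = (\pi_ratfun x)%qT by rewrite reprK.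
apply: (canRL (mulfK _)); first by rewrite tofrac_eq0.
rewrite -[LHS]/(FracField.mul _ _) !piE.
apply/eqmodP; rewrite /= FracField.equivfE /FracField.mulf.
by rewrite !numden_Ratio ?oner_eq0 ?mulr1 // mulrC.
Qed.

Lemma rnum_rden f :
  [/\ rden f != 0, coprimep (rnum f) (rden f) & f = (rnum f)%:F / (rden f)%:F].
Proof.
rewrite /rnum /rden; case E: (frac (repr f)) => [p q].
have q0 : q != 0 by have := denom_ratioP (repr f); rewrite E.
have g0 : gcdp p q != 0 by rewrite gcdp_eq0 negb_and q0 orbT.
have pE : p = p %/ gcdp p q * gcdp p q by rewrite divpK // dvdp_gcdl.
have qE : q = q %/ gcdp p q * gcdp p q by rewrite divpK // dvdp_gcdr.
have q1 : q %/ gcdp p q != 0.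
  by apply: contraNneq q0 => q1; rewrite qE q1 mul0r.
split=> //; first by apply: coprimep_div_gcd; rewrite q0 orbT.
rewrite [LHS]frac_reprE E /= {1}pE {3}qE !tofracM -mulf_div divff ?mulr1 //.
by rewrite tofrac_eq0.
Qed.

(* [z] is not a pole of [f] and [f] takes there the value [c]. *)
Definition evalto f z c := exists p q,
  [/\ q.[z] != 0, f = p%:F / q%:F & c = p.[z] / q.[z]].

(** Cross-multiplication compares the given fraction with the reduced one. If the reduced
    denominator vanished at z, so would the reduced numerator, against coprimality. *)
Lemma evalto_frac f z p q : f = p%:F / q%:F -> q.[z] != 0 ->
  (rden f).[z] != 0 /\ p.[z] * (rden f).[z] = (rnum f).[z] * q.[z].
Proof.
move=> fE qz; have [d0 cop E] := rnum_rden f.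
have q0 : q != 0 by apply: contraNneq qz => ->; rewrite horner0.
have H : p * rden f = rnum f * q.
  apply/eqP; rewrite -tofrac_eq !tofracM -eqr_div ?tofrac_eq0 //.
  by rewrite -fE -E.
have Hz := congr1 (fun r => r.[z]) H; rewrite /= !hornerM in Hz.
split=> //; apply: contraTneq cop => dz.
have : root (rden f) z by rewrite /root dz.
move=> /coprimep_root cr; apply/negP; rewrite coprimep_sym => /cr.
by apply/negP; rewrite negbK; move/eqP: Hz; rewrite dz mulr0 eq_sym mulf_eq0 (negbTE
  qz) orbF.
Qed.

Lemma evalto_reval f z c : evalto f z c -> reval f z = c.
Proof.
move=> [p [q [qz fE ->]]]; have [dz H] := evalto_frac fE qz.
by apply/eqP; rewrite eqr_div // H.
Qed.

Lemma evalto_rzero f z c : evalto f z c -> rzero f z <-> c = 0.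
Proof.
move=> ev; have [p [q [qz fE cE]]] := ev; have [dz H] := evalto_frac fE qz.
rewrite /rzero /root -(evalto_reval ev) /reval; split=> [/eqP ->|/eqP].
  by rewrite mul0r.
by rewrite mulf_eq0 invr_eq0 (negbTE dz) orbF.
Qed.

Lemma evalto_eq f z c d : evalto f z c -> evalto f z d -> c = d.
Proof. by move=> /evalto_reval <- /evalto_reval. Qed.

Lemma evalto_rden f z c : evalto f z c -> (rden f).[z] != 0.
Proof. by move=> [p [q [qz fE _]]]; have [] := evalto_frac fE qz. Qed.

Lemma evalto_poly p z : evalto p%:F z p.[z].
Proof. by exists p, 1; rewrite hornerC tofrac1 !divr1 oner_neq0. Qed.

Lemma evalto_const c z : evalto (rconst c) z c.
Proof. by have := evalto_poly c%:P z; rewrite hornerC. Qed.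

Lemma evalto1 z : evalto 1 z 1.
Proof. by have := evalto_poly 1 z; rewrite hornerC tofrac1. Qed.

Lemma evalto0 z : evalto 0 z 0.
Proof. by have := evalto_poly 0 z; rewrite horner0 tofrac0. Qed.

Lemma evalto_var z : evalto (rvar R) z z.
Proof. by have := evalto_poly 'X z; rewrite hornerX. Qed.

Lemma evaltoM f g z c d : evalto f z c -> evalto g z d -> evalto (f * g) z (c * d).
Proof.
move=> [p [q [qz -> ->]]] [p' [q' [q'z -> ->]]]; exists (p * p'), (q * q').
by rewrite !hornerM !tofracM !mulf_div mulf_neq0.
Qed.

Lemma evaltoD f g z c d : evalto f z c -> evalto g z d -> evalto (f + g) z (c + d).
Proof.
move=> [p [q [qz -> ->]]] [p' [q' [q'z -> ->]]].
exists (p * q' + p' * q), (q * q'); rewrite hornerD !hornerM tofracD !tofracM.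
have nz (r : {poly C}) : r.[z] != 0 -> r%:F != 0 :> ratfun.
  by move=> rz; rewrite tofrac_eq0; apply: contraNneq rz => ->; rewrite horner0.
by rewrite mulf_neq0 // !addf_div ?nz.
Qed.

Lemma evaltoN f z c : evalto f z c -> evalto (- f) z (- c).
Proof.
move=> ev; rewrite -mulN1r -[- c]mulN1r; apply: evaltoM ev.
by have := evalto_const (-1) z; rewrite /rconst polyCN tofracN polyC1 tofrac1.
Qed.

Lemma evaltoV f z c : evalto f z c -> c != 0 -> evalto f^-1 z c^-1.
Proof.
move=> [p [q [qz -> ->]]] c0; exists q, p; rewrite !invf_div; split=> //.
by apply: contraNneq c0 => ->; rewrite mul0r.
Qed.

Lemma evalto_div f g z c d : evalto f z c -> evalto g z d -> d != 0 ->
  evalto (f / g) z (c / d).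
Proof. by move=> fc gd d0; apply: evaltoM => //; apply: evaltoV. Qed.

Lemma evaltoX f z c k : evalto f z c -> evalto (f ^+ k) z (c ^+ k).
Proof.
move=> fc; elim: k => [|k IH]; first by rewrite !expr0; exact: evalto1.
by rewrite !exprS; apply: evaltoM.
Qed.

Lemma evalto_sum n (F : 'I_n -> ratfun) z (c : 'I_n -> C) : (forall i, evalto (F i) z
  (c i)) ->
  evalto (\sum_i F i) z (\sum_i c i).
Proof.
by move=> ev; elim/big_ind2: _ => // *; [exact: evalto0|exact: evaltoD].
Qed.

Lemma evalto_prod (r : seq nat) (F : nat -> ratfun) z (c : nat -> C) :
  (forall k, k \in r -> evalto (F k) z (c k)) ->
  evalto (\prod_(k <- r) F k) z (\prod_(k <- r) c k).
Proof.
elim: r => [|k r IH] ev; first by rewrite !big_nil; exact: evalto1.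
rewrite !big_cons; apply: evaltoM; first by apply: ev; rewrite mem_head.
by apply: IH => j jr; apply: ev; rewrite inE jr orbT.
Qed.

Lemma conj_circle z : `|z| = 1 -> z^-1 = z^*.
Proof. by move=> z1; rewrite invC_norm z1 expr1n invr1 mul1r. Qed.

Lemma circle_neq0 z : `|z| = 1 -> z != 0.
Proof. by move=> z1; rewrite -normr_gt0 z1 ltr01. Qed.

(** On the circle 1/z is the conjugate of z, so conjugating the coefficients and substituting 1/z
    conjugates the value. *)
Lemma evalto_conj_poly p z : `|z| = 1 ->
  evalto (map_poly (fun c => rconst c^*) p).[(rvar R)^-1] z (p.[z])^*.
Proof.
move=> z1; rewrite /map_poly horner_poly horner_coef rmorph_sum /=.
apply: evalto_sum => i; rewrite rmorphM rmorphXn /= -(conj_circle z1).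
apply: evaltoM; first exact: evalto_const.
by apply: evaltoX; apply: evaltoV; [exact: evalto_var|exact: circle_neq0].
Qed.

Lemma evalto_rstar f z c : `|z| = 1 -> evalto f z c -> evalto (rstar f) z c^*.
Proof.
move=> z1 fc; have dz := evalto_rden fc.
rewrite -(evalto_reval fc) /reval fmorph_div /=.
apply: evalto_div; [exact: evalto_conj_poly|exact: evalto_conj_poly|].
by rewrite conjC_eq0.
Qed.

Lemma rstar1 : rstar (1 : ratfun) = 1.
Proof.
(* The reduced numerator and denominator of 1 are only known to be equal. Their common transform can
   be cancelled because its value at 1 is nonzero. *)
have E : rnum (1 : ratfun) = rden 1.
  rewrite /rnum /rden; have := frac_reprE 1; case Ef: (frac _) => [p q] /=.
  have q0 : q != 0 by have := denom_ratioP (repr (1 : ratfun)); rewrite Ef.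
  move/esym/(canRL (divfK _)); rewrite mul1r tofrac_eq0 => /(_ q0)/eqP.
  by rewrite tofrac_eq => /eqP ->.
rewrite /rstar E divff //.
have n1 : `|1 : C| = 1 by rewrite normr1.
apply/eqP => e0; have := evalto_conj_poly (rden (1 : ratfun)) n1.
rewrite e0 => /evalto_eq/(_ (evalto0 1))/eqP.
by rewrite conjC_eq0; apply/negP/(evalto_rden (evalto1 1)).
Qed.

End RationalEvaluation.

(** * Orthogonal rational functions on the circle *)

Section RationalFunctionsOnCircle.
Variable R : realType.
Local Notation C := R[i].
Variables (alpha a : nat -> C) (phi : nat -> ratfun R).
Hypothesis alpha0 : alpha 0%N = 0.
Hypothesis alpha_lt1 : forall k, `|alpha k| < 1.
Hypothesis phi0 : phi 0%N = 1.
Hypothesis a_lt1 : forall k, `|a k.+1| < 1.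
Hypothesis phi_rec : forall k, phi k.+1 =
  rconst (enorm alpha a k.+1) * (varpi alpha k / varpi alpha k.+1) *
  (zeta alpha k * phi k + rconst (a k.+1) * superstar alpha phi k).
Hypothesis star_rec : forall k, superstar alpha phi k.+1 =
  rconst (enorm alpha a k.+1) * (varpi alpha k / varpi alpha k.+1) *
  (rconst (a k.+1)^* * (zeta alpha k * phi k) + superstar alpha phi k).

Lemma superstar0 : superstar alpha phi 0 = 1.
Proof. by rewrite /superstar /Blaschke big_geq // mul1r phi0 rstar1. Qed.

Lemma evalto_varpi k z : evalto (varpi alpha k) z (1 - (alpha k)^* * z).
Proof.
apply: evaltoD; first exact: evalto1.
by apply: evaltoN; apply: evaltoM; [exact: evalto_const|exact: evalto_var].
Qed.

Lemma evalto_varpi_star k z : evalto (varpi_star alpha k) z (z - alpha k).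
Proof.
by apply: evaltoD; [exact: evalto_var|apply: evaltoN; exact: evalto_const].
Qed.

Local Notation e k := (sqrtC (1 - `|alpha k| ^+ 2)).
Local Notation rho k := (sqrtC (1 - `|a k| ^+ 2)).

Lemma one_sub_alpha_gt0 k : 0 < 1 - `|alpha k| ^+ 2.
Proof. by rewrite subr_gt0 expr_lt1. Qed.

Lemma one_sub_a_gt0 k : 0 < 1 - `|a k.+1| ^+ 2.
Proof. by rewrite subr_gt0 expr_lt1. Qed.

Lemma eta_neq0 k : e k != 0.
Proof. by rewrite sqrtC_eq0 gt_eqF // one_sub_alpha_gt0. Qed.

Lemma rho_neq0 k : rho k.+1 != 0.
Proof. by rewrite sqrtC_eq0 gt_eqF // one_sub_a_gt0. Qed.

Lemma enormE k : enorm alpha a k.+1 = e k.+1 / e k / rho k.+1.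
Proof.
have ge0 j : 0 <= 1 - `|alpha j| ^+ 2 by rewrite ltW // one_sub_alpha_gt0.
have ag0 : 0 <= 1 - `|a k.+1| ^+ 2 by rewrite ltW // one_sub_a_gt0.
rewrite /enorm /= !(evalto_reval (evalto_varpi _ _)) -!normCKC.
by rewrite !rootCMl ?mulr_ge0 ?invr_ge0 // !rootCV.
Qed.

(** * Values at a point of the circle *)

Section Point.
Variable z : C.
Hypothesis z1 : `|z| = 1.

Definition varpi_at k := 1 - (alpha k)^* * z.
Definition zeta_at k := (z - alpha k) / varpi_at k.

Lemma norm_varpi_star k : `|z - alpha k| = `|varpi_at k|.
Proof.
rewrite -[RHS]norm_conjC /varpi_at rmorphB rmorph1 rmorphM /= conjCK -(conj_circle z1).
rewrite -[LHS]mul1r -(normr1 C) -[RHS]mul1r -{2}z1 normr1 mul1r -normrM.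
by rewrite mulrBr mulr1 mulrCA divff ?mulr1 // (circle_neq0 z1).
Qed.

Lemma varpi_at_neq0 k : varpi_at k != 0.
Proof.
rewrite /varpi_at subr_eq0; apply: contraTneq (alpha_lt1 k) => E.
suff -> : `|alpha k| = 1 by rewrite ltxx.
by rewrite -[RHS](normr1 C) E normrM z1 mulr1 norm_conjC.
Qed.

Lemma norm_zeta_at k : `|zeta_at k| = 1.
Proof. by rewrite normrM normrV ?unitfE ?varpi_at_neq0 // norm_varpi_star divff //
  normr_eq0 varpi_at_neq0. Qed.

Lemma zeta_at_neq0 k : zeta_at k != 0.
Proof. exact/circle_neq0/norm_zeta_at. Qed.

Lemma evalto_zeta k : evalto (zeta alpha k) z (zeta_at k).
Proof.
by apply: evalto_div; [exact: evalto_varpi_star|exact: evalto_varpi|exact: varpi_at_neq0].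
Qed.

Lemma evalto_Blaschke k : evalto (Blaschke alpha k) z (\prod_(1 <= j < k.+1) zeta_at j).
Proof. by apply: evalto_prod => j _; exact: evalto_zeta. Qed.

Lemma norm_prod_zeta_at (r : seq nat) (s : nat -> nat) : `|\prod_(j <- r) zeta_at (s
  j)| = 1.
Proof. by rewrite normr_prod big1 // => j _; rewrite norm_zeta_at. Qed.

Definition even_at m := (\prod_(1 <= j < m.+1) zeta_at (2 * j)%N)^*.

Lemma evalto_Blaschke_even_star m : evalto (rstar (Blaschke_even alpha m)) z (even_at m).
Proof. by apply: evalto_rstar => //; apply: evalto_prod => j _; exact: evalto_zeta. Qed.

Lemma norm_even_at m : `|even_at m| = 1.
Proof. by rewrite norm_conjC norm_prod_zeta_at. Qed.

(** [even_at] is a product of conjugates of unimodular numbers, so multiplying by zeta_{2m+2}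
    removes its last factor. *)
Lemma zeta_at_even_at m : zeta_at m.*2.+2 * even_at m.+1 = even_at m.
Proof.
rewrite /even_at big_nat_recr //= rmorphM /= mulrCA.
have -> : (2 * m.+1)%N = m.*2.+2 by lia.
by rewrite -normCK norm_zeta_at expr1n mulr1.
Qed.

Definition phi_at k := reval (phi k) z.
Definition star_at k := reval (superstar alpha phi k) z.

(** The point is the absence of poles on the circle. Both functions are treated together, by
    induction along the recurrence, whose denominators do not vanish there. *)
Lemma evalto_phi_star k :
  evalto (phi k) z (phi_at k) /\ evalto (superstar alpha phi k) z (star_at k).
Proof.
suff [[c ec] [d ed]] : (exists c, evalto (phi k) z c) /\
    (exists d, evalto (superstar alpha phi k) z d).
  by rewrite /phi_at /star_at (evalto_reval ec) (evalto_reval ed).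
elim: k => [|k [[c ec] [d ed]]].
  by rewrite superstar0 phi0; split; exists 1; exact: evalto1.
have pre : evalto (rconst (enorm alpha a k.+1) * (varpi alpha k / varpi alpha k.+1)) z
    (enorm alpha a k.+1 * (varpi_at k / varpi_at k.+1)).
  apply: evaltoM; first exact: evalto_const.
  by apply: evalto_div; [exact: evalto_varpi|exact: evalto_varpi|exact: varpi_at_neq0].
rewrite phi_rec star_rec; split; eexists; apply: evaltoM pre _; apply: evaltoD.
- by apply: evaltoM ec; exact: evalto_zeta.
- by apply: evaltoM ed; exact: evalto_const.
- by apply: evaltoM; [exact: evalto_const|apply: evaltoM ec; exact: evalto_zeta].
- exact: ed.
Qed.

Definition evalto_phi k := (evalto_phi_star k).1.
Definition evalto_star k := (evalto_phi_star k).2.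

Lemma phi_star_at_rec k :
  phi_at k.+1 = enorm alpha a k.+1 * (varpi_at k / varpi_at k.+1) * (zeta_at k * phi_at
    k + a k.+1 * star_at k) /\
  star_at k.+1 = enorm alpha a k.+1 * (varpi_at k / varpi_at k.+1) * ((a k.+1)^* *
    (zeta_at k * phi_at k) + star_at k).
Proof.
have pre : evalto (rconst (enorm alpha a k.+1) * (varpi alpha k / varpi alpha k.+1)) z
    (enorm alpha a k.+1 * (varpi_at k / varpi_at k.+1)).
  apply: evaltoM; first exact: evalto_const.
  by apply: evalto_div; [exact: evalto_varpi|exact: evalto_varpi|exact: varpi_at_neq0].
have ez := evaltoM (evalto_zeta k) (evalto_phi k).
split; apply: evalto_reval; rewrite ?phi_rec ?star_rec; apply: evaltoM pre _; apply:
  evaltoD.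
- exact: ez.
- by apply: evaltoM (evalto_star k); exact: evalto_const.
- by apply: evaltoM ez; exact: evalto_const.
- exact: evalto_star.
Qed.

(** The weight varpi_k / eta_k absorbs the prefactor of the recurrence, which becomes the Szego
    recurrence with the sole normalization 1 / rho. *)
Definition phi_scaled k := varpi_at k * phi_at k / e k.
Definition star_scaled k := varpi_at k * star_at k / e k.
Definition zeta_phi_scaled k := zeta_at k * phi_scaled k.

Lemma phi_scaled_rec k : phi_scaled k.+1 = (zeta_phi_scaled k + a k.+1 * star_scaled k)
  / rho k.+1.
Proof.
rewrite /zeta_phi_scaled /phi_scaled /star_scaled (phi_star_at_rec k).1 enormE.
have := (eta_neq0 k, eta_neq0 k.+1, rho_neq0 k, varpi_at_neq0 k.+1).
move: (e k) (e k.+1) (rho k.+1) => x y r [[[x0 y0] r0] v0].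
by field; rewrite x0 y0 r0 v0.
Qed.

Lemma star_scaled_rec k : star_scaled k.+1 = ((a k.+1)^* * zeta_phi_scaled k +
  star_scaled k) / rho k.+1.
Proof.
rewrite /zeta_phi_scaled /phi_scaled /star_scaled (phi_star_at_rec k).2 enormE.
have := (eta_neq0 k, eta_neq0 k.+1, rho_neq0 k, varpi_at_neq0 k.+1).
move: (e k) (e k.+1) (rho k.+1) => x y r [[[x0 y0] r0] v0].
by field; rewrite x0 y0 r0 v0.
Qed.

(** Together with [szego_step_star] this is the recurrence solved for other unknowns: Theta_{k+1}
    sends the pair ([star_scaled k], [phi_scaled k.+1]) to ([zeta_phi_scaled k],
    [star_scaled k.+1]). *)
Lemma szego_step_phi k : zeta_phi_scaled k = - a k.+1 * star_scaled k + rho k.+1 *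
  phi_scaled k.+1.
Proof.
rewrite phi_scaled_rec; have := rho_neq0 k; move: (rho _) => r r0; by field.
Qed.

Lemma szego_step_star k : star_scaled k.+1 = rho k.+1 * star_scaled k + (a k.+1)^* *
  phi_scaled k.+1.
Proof.
rewrite star_scaled_rec phi_scaled_rec.
have r2 : rho k.+1 * rho k.+1 = 1 - a k.+1 * (a k.+1)^* by rewrite -expr2 sqrtCK normCK.
have r0 := rho_neq0 k; move: (rho _) (a k.+1)^* r2 r0 => r c r2 r0.
transitivity ((r * r * star_scaled k + c * (zeta_phi_scaled k + a k.+1 * star_scaled
  k)) / r); last by field.
by rewrite r2; congr (_ / _); ring.
Qed.

Lemma phi_at0 : phi_at 0 = 1.
Proof. by rewrite /phi_at phi0 (evalto_reval (evalto1 z)). Qed.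

Lemma star_at0 : star_at 0 = 1.
Proof. by rewrite /star_at superstar0 (evalto_reval (evalto1 z)). Qed.

Lemma star_scaled0 : star_scaled 0 = 1.
Proof. by rewrite /star_scaled /varpi_at star_at0 alpha0 conjC0 normr0 expr0n subr0
  sqrtC1 mul0r subr0 !mulr1 divr1. Qed.

Lemma phi_scaled0 : phi_scaled 0 = star_scaled 0.
Proof. by rewrite /phi_scaled phi_at0 /star_scaled star_at0. Qed.

Lemma evalto_chi k :
  evalto (chi alpha phi k) z (even_at k./2 * (if odd k then phi_at k else star_at k)).
Proof.
apply: evaltoM; first exact: evalto_Blaschke_even_star.
by case: ifP => _; [exact: evalto_phi|exact: evalto_star].
Qed.

Definition chi_at k := reval (chi alpha phi k) z.

Lemma chi_atE k : chi_at k = even_at k./2 * (if odd k then phi_at k else star_at k).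
Proof. exact/evalto_reval/evalto_chi. Qed.

(** On the circle the superstar is a unimodular Blaschke value times the conjugate of phi_k. Through
    [norm_chi_at] this lets the quadrature weights, defined by phi, normalise the rows chi. *)
Lemma norm_star_at k : `|star_at k| = `|phi_at k|.
Proof.
have -> : star_at k = (\prod_(1 <= j < k.+1) zeta_at j) * (phi_at k)^*.
  apply: evalto_reval; apply: evaltoM; first exact: evalto_Blaschke.
  by apply: evalto_rstar => //; exact: evalto_phi.
by rewrite normrM norm_conjC (norm_prod_zeta_at _ id) mul1r.
Qed.

Lemma norm_chi_at k : `|chi_at k| = `|phi_at k|.
Proof. by rewrite chi_atE normrM norm_even_at mul1r; case: ifP; rewrite ?norm_star_at.
  Qed.

Lemma chi_at0 : chi_at 0 = 1.
Proof. by rewrite chi_atE /= star_at0 /even_at big_geq // conjC1 mulr1. Qed.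

Lemma szego_X_at k : szego_X phi_scaled star_scaled even_at k = chi_at k / e k * (1 - z
  * (alpha k)^*).
Proof.
rewrite chi_atE /szego_X /phi_scaled /star_scaled /varpi_at [z * _]mulrC.
by case: ifP => _; ring.
Qed.

Variables (n : nat) (v : C).
Hypothesis n_gt0 : (0 < n)%N.
Hypothesis v1 : `|v| = 1.

Local Notation u := ((v + a n) / (1 + (a n)^* * v)).

Lemma u_den_neq0 : 1 + (a n)^* * v != 0.
Proof.
rewrite addrC addr_eq0; apply/eqP => E; have := congr1 Num.norm E.
rewrite normrN normr1 normrM v1 mulr1 norm_conjC; case: n n_gt0 => // m _ E1.
by have := a_lt1 m; rewrite E1 ltxx.
Qed.

Lemma norm_u : `|u| = 1.
Proof.
rewrite normrM normrV ?unitfE ?u_den_neq0 //.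
have -> : `|v + a n| = `|1 + (a n)^* * v|.
  rewrite -[LHS]norm_conjC -[LHS]mulr1 -v1 -normrM rmorphD mulrDl /=.
  by rewrite -normCKC v1 expr1n.
by rewrite divff // normr_eq0 u_den_neq0.
Qed.

(** The recurrence turns the scaled value of Q times rho_n into (1 + conj(a_n) v) (H + u G), with H
    and G the last [zeta_phi_scaled] and [star_scaled]; all the other factors are nonzero. *)
Lemma para_eq0 : phi_at n + v * star_at n = 0 <-> zeta_phi_scaled n.-1 = - u *
  star_scaled n.-1.
Proof.
have d0 := u_den_neq0; case: n n_gt0 d0 => // m _ d0 /=.
have r0 := rho_neq0 m; have e0 := eta_neq0 m.+1; have vp0 := varpi_at_neq0 m.+1.
have E : rho m.+1 * (phi_scaled m.+1 + v * star_scaled m.+1) =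
    (1 + (a m.+1)^* * v) * (zeta_phi_scaled m + (v + a m.+1) / (1 + (a m.+1)^* * v) *
      star_scaled m).
  rewrite phi_scaled_rec star_scaled_rec.
  move: r0 d0; move: (rho m.+1) (a m.+1)^* => r c r0 d0; field; by rewrite r0 d0.
have E2 : phi_scaled m.+1 + v * star_scaled m.+1 = varpi_at m.+1 / e m.+1 * (phi_at
  m.+1 + v * star_at m.+1).
  by rewrite /phi_scaled /star_scaled; move: e0; move: (e m.+1) => x x0; field.
have k0 : rho m.+1 * (varpi_at m.+1 / e m.+1) != 0 by rewrite !mulf_neq0 // invr_eq0.
rewrite E2 mulrA in E; split=> [H|H].
  move: E; rewrite H mulr0 => /esym/eqP; rewrite mulf_eq0 (negbTE d0) /=.
  by rewrite addr_eq0 mulNr => /eqP.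
by apply: (mulfI k0); rewrite E H mulr0; ring.
Qed.

Local Notation U := (op_mobius (principal (Amx alpha) n) (CMV_u a n u)).
Local Notation chi_row := (\row_(k < n) chi_at k).
Local Notation a' := (fun k => if k == n then u else a k).

Lemma norm_a'_n : `|a' n| = 1.
Proof. by rewrite /= eqxx norm_u. Qed.

Lemma a'_lt1 k : (0 < k < n)%N -> `|a' k| < 1.
Proof.
by case/andP=> k0 kn; rewrite ltn_eqF //; case: k k0 kn.
Qed.

Lemma CMV_u_unitary : CMV_u a n u \is unitarymx.
Proof. by apply: CMV_unitary; [exact: n_gt0|exact: norm_a'_n|exact: a'_lt1]. Qed.

Lemma op_mobius_CMV_unitary : U \is unitarymx.
Proof. by apply: op_mobius_unitary => //; exact: CMV_u_unitary. Qed.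

Lemma szego_step_truncated : zeta_phi_scaled n.-1 = - u * star_scaled n.-1 ->
  forall k, (k < n)%N ->
  zeta_phi_scaled k = - a' k.+1 * star_scaled k + sqrtC (1 - `|a' k.+1| ^+ 2) *
    phi_scaled k.+1.
Proof.
move=> Q0 k kn /=; have [kn1|_] := eqVneq k.+1 n; last exact: szego_step_phi.
rewrite norm_u expr1n subrr sqrtC0 mul0r addr0; move: Q0.
by have -> : n.-1 = k by lia.
Qed.

Lemma chi_row_eigen : phi_at n + v * star_at n = 0 -> chi_row *m U = z *: chi_row.
Proof.
have alpha_lt1' k : (k < n)%N -> `|alpha k| < 1 by [].
move/para_eq0 => Q0; apply/(op_mobius_eigen alpha_lt1' CMV_u_unitary) => j.
rewrite (@mul_CMV _ a' n n_gt0 norm_a'_n _ (szego_X phi_scaled star_scaled even_at));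
  last first.
  by move=> i; rewrite !mxE szego_X_at.
rewrite -(@szego_eigen _ a' n n_gt0 norm_a'_n phi_scaled star_scaled zeta_phi_scaled
  zeta_at even_at) //; last first.
- exact: szego_step_truncated.
- by move=> k kn; rewrite ltn_eqF //; exact: szego_step_star.
- exact: phi_scaled0.
- exact: zeta_at_even_at.
rewrite szego_X_at !mxE /zeta_at /varpi_at.
have := varpi_at_neq0 j; rewrite /varpi_at; move: (e j) (eta_neq0 j) => y y0 v0.
by field; rewrite v0 y0.
Qed.

Lemma eigen_chi_row (x : 'rV[C]_n) : x *m U = z *: x -> x != 0 ->
  phi_at n + v * star_at n = 0 /\ exists2 c : C, c != 0 & x = c *: chi_row.
Proof.
have alpha_lt1' k : (k < n)%N -> `|alpha k| < 1 by [].
move=> /(op_mobius_eigen alpha_lt1' CMV_u_unitary) xU x0.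
(* The row is extended by 0 to all indices; the values from n on meet only the vanishing rho_n. *)
pose xn k := if insub k is Some i then x 0 i else 0.
have xnE (i : 'I_n) : xn i = x 0 i by rewrite /xn valK.
pose X k := xn k / e k * (1 - z * (alpha k)^*).
have {}xU k : (k < n)%N -> zeta_at k * X k =
    CMV_e_diag a' k * CMV_half a' X k + CMV_e_off a' k * CMV_half a' X (even_mate k).
  move=> kn; pose i := Ordinal kn.
  rewrite -(@mul_CMV _ a' n n_gt0 norm_a'_n (\row_i X i) X i); last by move=> ?;
    rewrite mxE.
  have -> : \row_i X i = \row_j (x 0 j / e j * (1 - z * (alpha j)^*)).
    by apply/rowP => j; rewrite !mxE /X xnE.
  rewrite -[principal _ _]/(CMV_u a n u) -xU /X -(xnE i) /= /zeta_at /varpi_at.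
  have := varpi_at_neq0 k; rewrite /varpi_at; move: (e k) (eta_neq0 k) => y y0 v0.
  by field; rewrite v0 y0.
have a'E k : (k.+1 < n)%N -> a' k.+1 = a k.+1 by move=> kn /=; rewrite ltn_eqF.
have SG k : (k.+1 < n)%N -> star_scaled k.+1 =
    sqrtC (1 - `|a' k.+1| ^+ 2) * star_scaled k + (a' k.+1)^* * phi_scaled k.+1.
  by move=> kn; rewrite a'E //; exact: szego_step_star.
have SH k : (k.+1 < n)%N -> zeta_phi_scaled k =
    - a' k.+1 * star_scaled k + sqrtC (1 - `|a' k.+1| ^+ 2) * phi_scaled k.+1.
  by move=> kn; rewrite a'E //; exact: szego_step_phi.
have Sr k : (k.+1 < n)%N -> sqrtC (1 - `|a' k.+1| ^+ 2) != 0.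
  by move=> kn; rewrite a'E //; exact: rho_neq0.
have b0 : even_at 0 = 1 by rewrite /even_at big_geq // conjC1.
have bn m : even_at m != 0 by apply/circle_neq0/norm_even_at.
have ztF k : zeta_at k * phi_scaled k = zeta_phi_scaled k by [].
have XE k : (k < n)%N -> X k = X 0%N * szego_X phi_scaled star_scaled even_at k.
  move=> kn.
  by have [] := @szego_unique _ a' n n_gt0 phi_scaled star_scaled zeta_phi_scaled
    zeta_at even_at ztF zeta_at_even_at phi_scaled0 SG SH Sr zeta_at_neq0 star_scaled0
    b0 X xU k kn.
have xE : x = X 0%N *: chi_row.
  apply/rowP => i; rewrite !mxE; have := XE i (ltn_ord i).
  rewrite szego_X_at /X xnE [z * _]mulrC -/(varpi_at i) => E.
  have k0 : (e i)^-1 * varpi_at i != 0 by rewrite mulf_neq0 ?varpi_at_neq0 // invr_eq0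
    eta_neq0.
  by apply: (mulIf k0); rewrite mulrA E !mulrA.
have X0 : X 0%N != 0 by apply: contraNneq x0 => X0; rewrite xE X0 scale0r.
split; last by exists (X 0%N).
apply/para_eq0.
have := @szego_end _ a' n n_gt0 norm_a'_n phi_scaled star_scaled zeta_phi_scaled
  zeta_at even_at ztF zeta_at_even_at phi_scaled0 SG SH Sr zeta_at_neq0 star_scaled0 b0
  X xU bn X0.
by rewrite /= eqxx.
Qed.

End Point.
End RationalFunctionsOnCircle.

(** * Spectra of unitary matrices *)

Lemma adjmxZ (F : numClosedFieldType) m n (a : F) (A : 'M[F]_(m, n)) :
  (a *: A) ^t* = a^* *: A ^t*.
Proof. by rewrite linearZ /= map_mxZ. Qed.

Section UnitaryEigenvectors.
Variables (F : numClosedFieldType) (n : nat) (U : 'M[F]_n).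
Hypothesis Uu : U \is unitarymx.

Lemma unitary_eigenvalue_norm (x : 'rV[F]_n) l : x *m U = l *: x -> x != 0 -> `|l| = 1.
Proof.
move=> xU x0; have : (x *m U) *m (x *m U) ^t* = x *m x ^t*.
  by rewrite adjmxM mulmxA mulmxtVK.
rewrite xU => /matrixP/(_ 0 0); rewrite !mxE.
have -> : \sum_j (l *: x) 0 j * (l *: x) ^t* j 0 = `|l| ^+ 2 * \sum_j x 0 j * x ^t* j 0.
  rewrite mulr_sumr; apply: eq_bigr => j _.
  by rewrite !mxE rmorphM /= mulrACA (normCK l).
have [i xi] : exists i, x 0 i != 0 by apply/rV0Pn.
have s0 : \sum_j x 0 j * x ^t* j 0 != 0.
  rewrite psumr_neq0; last by move=> j _; rewrite !mxE mul_conjC_ge0.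
  by apply/hasP; exists i; rewrite ?mem_index_enum //= !mxE mul_conjC_gt0.
move/(canRL (mulfK s0)); rewrite divff // => /eqP.
by rewrite sqrf_eq1 => /orP[] /eqP // l1; have := normr_ge0 l; rewrite l1 ler0N1.
Qed.

(** The recurrence yields eigenrows, while the eigenvectors sought are columns; for a unimodular
    eigenvalue of a unitary matrix, taking adjoints exchanges the two. *)
Lemma unitary_eigen_adj (x : 'rV[F]_n) l : `|l| = 1 ->
  x *m U = l *: x <-> U *m x ^t* = l *: x ^t*.
Proof.
move=> l1; have ll : l * l^* = 1 by rewrite -normCK l1 expr1n.
have UU : U ^t* *m U = 1%:M by rewrite -invmx_unitary // mulVmx // unitarymx_unit.
split=> [xU|].
  have : (x *m U) ^t* = l^* *: x ^t* by rewrite xU adjmxZ.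
  rewrite adjmxM => /(congr1 (mulmx (l *: U))); rewrite -scalemxAl mulmxA.
  by rewrite (unitarymxP Uu) mul1mx -scalemxAr -scalemxAl scalerA mulrC ll scale1r => ->.
move=> /(congr1 (fun M => (M ^t*) *m (l *: U))); rewrite adjmxM trmxCK.
rewrite -scalemxAr -mulmxA UU mulmx1 => ->.
by rewrite adjmxZ trmxCK -scalemxAl -scalemxAr scalerA mulrC ll scale1r.
Qed.

(** In the application [zero] is the vanishing of Q and [w z] the row chi(z). By [eigen_w] every
    eigenspace is at most a line. *)
Variables (zero : F -> Prop) (w : F -> 'rV[F]_n).
Hypothesis w_neq0 : forall z, zero z -> `|z| = 1 -> w z != 0.
Hypothesis w_eigen : forall z, zero z -> `|z| = 1 -> w z *m U = z *: w z.
Hypothesis eigen_w : forall z (x : 'rV[F]_n), x *m U = z *: x -> x != 0 ->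
  zero z /\ exists2 c, c != 0 & x = c *: w z.

(** The rows of a unitary diagonalizing matrix P are multiples of rows [w (s i)]. Two equal
    eigenvalues would make two orthogonal rows proportional, so [s] is injective. The last clause
    expands M in this eigenbasis; keeping [h] general covers both the identity matrix and U. *)
Lemma unitary_simple_spectrum : exists s : 'I_n -> F, [/\ injective s,
  (forall i, zero (s i) /\ `|s i| = 1),
  (forall z, zero z -> `|z| = 1 -> exists i, z = s i),
  (forall i j, \sum_k w (s i) 0 k * (w (s j) 0 k)^* =
     (i == j)%:R * \sum_k `|w (s i) 0 k| ^+ 2) &
  (forall (h : F -> F) M, (forall z (x : 'rV[F]_n), x *m U = z *: x -> x *m M = h z *:
    x) ->
  forall j k, M j k = \sum_i (\sum_k `|w (s i) 0 k| ^+ 2)^-1 *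
     ((w (s i) 0 j)^* * (h (s i) * w (s i) 0 k)))].
Proof.
have /orthomx_spectralP : U \is normalmx.
  apply/normalmxP; rewrite (unitarymxP Uu).
  by rewrite -invmx_unitary // mulVmx // unitarymx_unit.
have Pu := spectral_unitarymx U.
set P := spectralmx U in Pu *; set d := spectral_diag U => UE.
have PU : P *m U = diag_mx d *m P by rewrite UE -mulmxA mulKVmx // unitarymx_unit.
pose s i := d 0 i.
have rP i : row i P *m U = s i *: row i P.
  by apply/rowP => k; rewrite -row_mul PU mul_diag_mx !mxE.
have PP i j : \sum_k P i k * (P j k)^* = (i == j)%:R.
  have /unitarymxP/matrixP/(_ i j) := Pu.
  by rewrite !mxE => <-; apply: eq_bigr => k _; rewrite !mxE.
have r0 i : row i P != 0.
  apply/eqP => /rowP r0; have := PP i i; rewrite eqxx big1 => [/esym/eqP|k _].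
    by rewrite oner_eq0.
  by have := r0 k; rewrite !mxE => ->; rewrite mul0r.
have ex i : exists c, c != 0 /\ row i P = c *: w (s i).
  by have [_ [c c0 E]] := eigen_w (rP i) (r0 i); exists c.
have [c cP] := fin_all_exists ex.
have PE i k : P i k = c i * w (s i) 0 k.
  by have [_ /rowP/(_ k)] := cP i; rewrite !mxE.
have ortho i j : c i * (c j)^* * \sum_k w (s i) 0 k * (w (s j) 0 k)^* = (i == j)%:R.
  rewrite -PP mulr_sumr; apply: eq_bigr => k _; rewrite !PE rmorphM /=.
  by rewrite mulrACA.
(* The normalization of row i fixes the modulus of its factor: |c_i|^2 is the inverse of the squared
   norm of [w (s i)]. *)
have c1 i : c i * (c i)^* = (\sum_k `|w (s i) 0 k| ^+ 2)^-1.
  have := ortho i i; rewrite eqxx; under eq_bigr do rewrite -normCK.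
  move=> E; rewrite -[RHS]mul1r; apply: (canRL (mulfK _)); rewrite ?E //.
  by apply/eqP => E0; move/eqP: E; rewrite E0 mulr0 eq_sym oner_eq0.
have Z i : zero (s i) by have [] := eigen_w (rP i) (r0 i).
have s1 i : `|s i| = 1 by exact: unitary_eigenvalue_norm (rP i) (r0 i).
exists s; split=> //.
- move=> i j E; apply/eqP; case: (eqVneq i j) => // ij.
  have := ortho i j; rewrite (negbTE ij) => /eqP; rewrite E.
  have [[ci _] [cj _]] := (cP i, cP j).
  rewrite !mulf_eq0 (negbTE ci) conjC_eq0 (negbTE cj) /= => /eqP E0.
  have := ortho j j; rewrite E0 mulr0 eqxx => /esym/eqP.
  by rewrite oner_eq0.
- move=> z zz z1; have wU := w_eigen zz z1; have w0 := w_neq0 zz z1.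
  (* These are the coordinates of [w z] in the eigenbasis; a nonzero coordinate i forces z = s i. *)
  have : w z *m invmx P != 0.
    by apply: contraNneq w0 => E; rewrite -(mulmxKV (unitarymx_unit Pu) (w z)) E mul0mx.
  case/rV0Pn => i yi; exists i; apply: (mulIf yi).
  have := congr1 (mulmx^~ (invmx P)) wU; rewrite {1}UE !mulmxA mulmxK ?unitarymx_unit //.
  rewrite -scalemxAl => /rowP/(_ i); rewrite mul_mx_diag !mxE => <-.
  by rewrite mulrC.
- move=> i j; case: (eqVneq i j) => [->|ij].
    by rewrite mul1r; apply: eq_bigr => k _; rewrite normCK.
  have := ortho i j; rewrite (negbTE ij) mul0r => /eqP.
  have [[ci _] [cj _]] := (cP i, cP j).
  by rewrite !mulf_eq0 (negbTE ci) conjC_eq0 (negbTE cj) /= => /eqP.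
move=> h M hM j k.
have -> : M = P ^t* *m (P *m M).
  by rewrite mulmxA -invmx_unitary // mulVmx ?mul1mx // unitarymx_unit.
rewrite mxE; apply: eq_bigr => i _; rewrite !mxE -c1.
have := hM _ _ (rP i); rewrite -row_mul => /rowP/(_ k); rewrite !mxE => ->.
by rewrite !PE rmorphM /=; ring.
Qed.

End UnitaryEigenvectors.

(** * Borel sets of the plane and discrete measures *)

Lemma horner_continuous (K : numFieldType) (p : {poly K}) : continuous (horner p).
Proof.
elim/poly_ind: p => [|p c IH].
  have -> : horner (0 : {poly K}) = cst 0 by apply/funext => t; rewrite horner0.
  exact: cst_continuous.
have -> : horner (p * 'X + c%:P) = (fun t => p.[t] * t + c).
  by apply/funext => t; rewrite hornerMXaddC.
move=> z; have Fz : Filter (nbhs z) by exact: nbhs_filter.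
apply: (@cvgD K K _ _ Fz).
  by apply: (@cvgM K K _ Fz); [exact: IH|exact: cvg_id].
exact: cst_continuous.
Qed.

Section BorelPlane.
Variable R : realType.
Local Notation C := R[i].
Local Notation K := (R[i] : numFieldType).
Local Open Scope classical_set_scope.

Lemma contraction_continuous (f : K -> R) :
  (forall x y : K, (`|f x - f y|%:C)%C <= `|x - y| :> C) -> continuous f.
Proof.
move=> fc z A /nbhs_ballP[e /= e0 eA]; apply/nbhs_ballP.
exists (e%:C)%C => /=; first by rewrite ltcR.
move=> t zt; apply: eA; move: zt; rewrite -!ball_normE /= => zt.
by rewrite -ltcR (le_lt_trans (fc _ _)).
Qed.

Lemma Re_continuous : continuous (fun z : K => complex.Re z : R).
Proof.
by apply: contraction_continuous => x y; rewrite -raddfB; exact: normc_ge_Re.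
Qed.

Lemma normc_ge_Im (x : C) : (`|complex.Im x|%:C)%C <= `|x|.
Proof.
have -> : complex.Im x = complex.Re (- 'i%C * x).
  by case: x => p q /=; ring.
have -> : `|x| = `|- 'i%C * x|.
  rewrite normrM normrN.
  have -> : `|'i%C : C| = 1 by rewrite normc_def /= expr0n expr1n add0r sqrtr1.
  by rewrite mul1r.
exact: normc_ge_Re.
Qed.

Lemma Im_continuous : continuous (fun z : K => complex.Im z : R).
Proof.
by apply: contraction_continuous => x y; rewrite -raddfB; exact: normc_ge_Im.
Qed.

Lemma conj_continuous : continuous (fun z : K => z^* : K).
Proof.
move=> z A /nbhs_ballP[e /= e0 eA]; apply/nbhs_ballP; exists e => //.
move=> t zt; apply: eA; move: zt; rewrite -!ball_normE /= => zt.
by rewrite -rmorphB /= norm_conjC.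
Qed.

Lemma norm_continuousC : continuous (fun z : K => complex.Re `|z| : R).
Proof.
move=> z; apply: (@continuous_comp _ _ _ (fun z : K => `|z| : K)); last exact:
  Re_continuous.
exact: norm_continuous.
Qed.

(** Continuity is assumed only at the points of [D], as rational functions may have poles elsewhere.
    A preimage of an open interval then agrees on [D] with its interior. *)
Lemma continuous_on_measurable (D : set K) (f : K -> R) : closed D ->
  (forall z, D z -> {for z, continuous f}) ->
  measurable_fun (D : set (borelC R)) (f : borelC R -> R).
Proof.
move=> cD cf; apply: (measurability _ (RGenOpens.measurableE R)).
move=> _ [_ [a [b ->] <-]].
set V := `]a, b[%classic; set A := f @^-1` V.
have -> : D `&` A = D `&` A^°.
  apply/seteqP; split => z [Dz Az]; split => //; last exact: interior_subset.
  by apply: cf => //; apply: open_nbhs_nbhs; split => //; exact: interval_open.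
apply: measurableI; last by apply: sub_sigma_algebra; exact: open_interior.
rewrite -[D]setCK; apply: measurableC; apply: sub_sigma_algebra.
exact/closed_openC.
Qed.

Lemma reval_continuous (f : ratfun R) (z : K) : (rden f).[z] != 0 ->
  {for z, continuous (fun t : K => reval f t : K)}.
Proof.
move=> dz; apply: continuousM; first exact: horner_continuous.
by apply: continuousV => //; exact: horner_continuous.
Qed.

Lemma closed_unit_circle : closed (@unit_circle R : set K).
Proof.
have -> : (@unit_circle R : set K) = (fun z : K => complex.Re `|z| : R) @^-1` [set 1%R].
  apply/seteqP; split => z z1; first exact: (congr1 (@complex.Re R) z1).
  have {}z1 : complex.Re `|z| = 1 := z1.
  by rewrite /unit_circle /= -[LHS]RRe_real ?normr_real // z1.
by apply: closed_comp => [z _|]; [exact: norm_continuousC|exact: closed_eq].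
Qed.

Lemma measurable_unit_circle : measurable (@unit_circle R).
Proof.
rewrite -[@unit_circle R]setCK; apply: measurableC; apply: sub_sigma_algebra.
exact/closed_openC/closed_unit_circle.
Qed.

End BorelPlane.

(** * Integrals against finite sums of point masses *)

Section DiscreteMeasure.
Context d (T : measurableType d) (R : realType).
Local Open Scope classical_set_scope.
Variables (D : set T) (N : nat) (pt : nat -> T) (m : nat -> {nonneg R}).
Hypothesis mD : measurable D.
Hypothesis ptD : forall i, (i < N)%N -> D (pt i).

Local Notation mu := (msum (fun i => mscale (m i) (dirac (pt i))) N).

Lemma ge0_integral_discrete (f : T -> \bar R) : measurable_fun D f ->
  (forall x, D x -> 0 <= f x)%E ->
  (\int[mu]_(x in D) f x = \sum_(i < N) (m i)%:num%:E * f (pt i))%E.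
Proof.
move=> mf f0; rewrite ge0_integral_measure_sum //; apply: eq_bigr => i _.
rewrite ge0_integral_mscale // integral_dirac // diracE mem_set ?mul1e //.
exact: ptD.
Qed.

Lemma integral_discrete (f : T -> R) : measurable_fun D f ->
  (\int[mu]_(x in D) (f x)%:E = (\sum_(i < N) (m i)%:num * f (pt i))%:E)%E.
Proof.
move=> mf; have mEf : measurable_fun D (EFin \o f) by exact/measurable_EFinP.
rewrite integralE !ge0_integral_discrete //; first last.
- exact: measurable_funepos.
- exact: measurable_funeneg.
transitivity ((\sum_(i < N) (m i)%:num * Num.max (f (pt i)) 0)%:E -
    (\sum_(i < N) (m i)%:num * Num.max (- f (pt i)) 0)%:E)%E.
  congr (_ - _)%E; rewrite -sumEFin; apply: eq_bigr => i _.
    by rewrite funeposE EFinM EFin_max.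
  by rewrite funenegE EFinM EFin_max EFinN.
rewrite -EFinB -sumrB; congr EFin; apply: eq_bigr => i _; rewrite -mulrBr; congr (_ * _).
by case: (leP (f (pt i)) 0) => f0; case: (leP (- f (pt i)) 0) => f1; lra.
Qed.

End DiscreteMeasure.

(** * Para-orthogonal functions *)

(** No assumption is made on [q] at z. This serves at zeros not yet known to lie on the circle,
    where [evalto] gives no information. *)
Lemma rzero_num (R : realType) (f : ratfun R) (p q : {poly R[i]}) z :
  f = p%:F / q%:F -> q != 0 -> rzero f z -> root p z.
Proof.
move=> fE q0 phi_at; have [d0 cop E] := rnum_rden f.
have H : p * rden f = rnum f * q.
  by apply/eqP; rewrite -tofrac_eq !tofracM -eqr_div ?tofrac_eq0 // -fE -E.
have dz : (rden f).[z] != 0 by exact: coprimep_root cop phi_at.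
have /eqP : (p * rden f).[z] = 0 by rewrite H hornerM (eqP phi_at) mul0r.
by rewrite hornerM mulf_eq0 (negbTE dz) orbF.
Qed.

(** With x = varpi_k, y = varpi_{k+1} and w = pi_k, the factor x cancels the denominator of zeta_k
    and leaves pi_{k+1} as the only denominator. *)
Lemma recurrence_frac (K : fieldType) (e s p r c x y w : K) :
  x != 0 -> y != 0 -> w != 0 ->
  e * (x / y) * (s / x * (p / w) + c * (r / w)) = e * (s * p + c * (x * r)) / (w * y) /\
  e * (x / y) * (c * (s / x * (p / w)) + r / w) = e * (c * (s * p) + x * r) / (w * y).
Proof. by move=> x0 y0 w0; split; field; rewrite x0 y0 w0. Qed.

Section CirclePoints.
Variable F : numClosedFieldType.

(* The Cayley transform of an integer. *)
Definition circle_point (t : nat) : F := (1 + t%:R * 'i) / (1 - t%:R * 'i).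

(** The product equals 1 + t^2; hence neither factor vanishes, in particular not the denominator of
    [circle_point]. *)
Lemma circle_point_mul (t : nat) : (1 + t%:R * 'i) * (1 - t%:R * 'i) != 0 :> F.
Proof.
have -> : (1 + t%:R * 'i) * (1 - t%:R * 'i) = 1 - t%:R ^+ 2 * 'i ^+ 2 :> F by ring.
by rewrite sqrCi mulrN1 opprK -natrX addrC natr1 pnatr_eq0.
Qed.

Lemma norm_circle_point t : `|circle_point t| = 1.
Proof.
have /[!mulf_eq0] := circle_point_mul t; rewrite negb_or => /andP[_ d0].
rewrite normrM normrV ?unitfE //.
have -> : 1 - t%:R * 'i = (1 + t%:R * 'i)^* :> F.
  by rewrite rmorphD rmorphM /= rmorph1 rmorph_nat conjCi mulrN.
by rewrite norm_conjC divff // normr_eq0 -conjC_eq0 rmorphD rmorphM /= rmorph1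
  rmorph_nat conjCi mulrN.
Qed.

Lemma circle_point_inj : injective circle_point.
Proof.
move=> t s; have /[!mulf_eq0] := circle_point_mul t; have /[!mulf_eq0] :=
  circle_point_mul s.
rewrite !negb_or => /andP[_ s0] /andP[_ t0] /eqP; rewrite eqr_div // -subr_eq0.
have -> : (1 + t%:R * 'i) * (1 - s%:R * 'i) - (1 + s%:R * 'i) * (1 - t%:R * 'i) =
   2%:R * 'i * (t%:R - s%:R) :> F by ring.
by rewrite !mulf_eq0 pnatr_eq0 (negbTE (neq0Ci _)) /= subr_eq0 eqr_nat => /eqP.
Qed.

End CirclePoints.

Section ParaOrthogonal.
Variable R : realType.
Local Notation C := R[i].
Variables (alpha a : nat -> C) (phi : nat -> ratfun R).
Hypothesis alpha0 : alpha 0%N = 0.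
Hypothesis alpha_lt1 : forall k, `|alpha k| < 1.
Hypothesis phi0 : phi 0%N = 1.
Hypothesis a_lt1 : forall k, `|a k.+1| < 1.
Hypothesis phi_rec : forall k, phi k.+1 =
  rconst (enorm alpha a k.+1) * (varpi alpha k / varpi alpha k.+1) *
  (zeta alpha k * phi k + rconst (a k.+1) * superstar alpha phi k).
Hypothesis star_rec : forall k, superstar alpha phi k.+1 =
  rconst (enorm alpha a k.+1) * (varpi alpha k / varpi alpha k.+1) *
  (rconst (a k.+1)^* * (zeta alpha k * phi k) + superstar alpha phi k).

Definition varpi_poly k : {poly C} := 1 - ((alpha k)^*)%:P * 'X.
Definition pi_poly k : {poly C} := \prod_(1 <= j < k.+1) varpi_poly j.

Lemma varpiE k : varpi alpha k = (varpi_poly k)%:F.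
Proof. by rewrite /varpi_poly tofracB tofrac1 tofracM. Qed.

Lemma pi_prodE k : pi_prod alpha k = (pi_poly k)%:F.
Proof. by rewrite rmorph_prod; apply: eq_bigr => j _; rewrite varpiE. Qed.

Lemma varpi_poly_circle k z : `|z| = 1 -> (varpi_poly k).[z] != 0.
Proof.
move=> z1; rewrite /varpi_poly hornerD hornerN hornerM !hornerC hornerX.
exact: varpi_at_neq0.
Qed.

Lemma pi_poly_circle k z : `|z| = 1 -> (pi_poly k).[z] != 0.
Proof.
move=> z1; rewrite horner_prod prodf_seq_neq0; apply/allP => j _ /=.
exact: varpi_poly_circle.
Qed.

Lemma varpi_poly_neq0 k : varpi_poly k != 0.
Proof.
apply: contraTneq (@varpi_poly_circle k 1 (normr1 _)) => ->.
by rewrite horner0 eqxx.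
Qed.

Lemma pi_poly_neq0 k : pi_poly k != 0.
Proof.
apply: contraTneq (@pi_poly_circle k 1 (normr1 _)) => ->.
by rewrite horner0 eqxx.
Qed.

Lemma size_varpi_poly k : (size (varpi_poly k) <= 2)%N.
Proof.
rewrite (leq_trans (size_polyD _ _)) // geq_max size_poly1 size_polyN /=.
by rewrite (leq_trans (size_polyMleq _ _)) // size_polyX size_polyC; case: (_ != 0).
Qed.

Lemma size_mul_le2 (p q : {poly C}) k :
  (size p <= 2)%N -> (size q <= k.+1)%N -> (size (p * q)%R <= k.+2)%N.
Proof. by move=> sp sq; rewrite (leq_trans (size_polyMleq _ _)) //; lia. Qed.

Lemma size_mulC_le (c : C) (p : {poly C}) k : (size p <= k)%N -> (size (c%:P * p)%R <=
  k)%N.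
Proof. by move=> sp; rewrite mul_polyC (leq_trans (size_scale_leq _ _)). Qed.

(** Induction on the recurrence. The bound of the degrees by k is what later leaves no room for
    roots of the numerator of Q other than the n eigenvalues. *)
Lemma phi_frac k : exists p r : {poly C}, [/\ (size p <= k.+1)%N, (size r <= k.+1)%N,
  phi k = p%:F / pi_prod alpha k & superstar alpha phi k = r%:F / pi_prod alpha k].
Proof.
elim: k => [|k [p [r [sp sr pE rE]]]].
  exists 1, 1; rewrite size_poly1 phi0 (superstar0 _ phi0) /pi_prod big_geq //.
  by rewrite tofrac1 divr1.
pose X := ('X - (alpha k)%:P) * p; pose Y := varpi_poly k * r.
have sX : (size X <= k.+2)%N by rewrite size_mul_le2 // size_XsubC.
have sY : (size Y <= k.+2)%N by rewrite size_mul_le2 // size_varpi_poly.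
exists ((enorm alpha a k.+1)%:P * (X + (a k.+1)%:P * Y)).
exists ((enorm alpha a k.+1)%:P * ((a k.+1)^*%:P * X + Y)).
have pk0 : pi_prod alpha k != 0 by rewrite pi_prodE tofrac_eq0 pi_poly_neq0.
have v0 j : varpi alpha j != 0 by rewrite varpiE tofrac_eq0 varpi_poly_neq0.
have XF : X%:F = varpi_star alpha k * p%:F.
  by rewrite tofracM tofracB.
have YF : Y%:F = varpi alpha k * r%:F by rewrite tofracM varpiE.
have piS : pi_prod alpha k.+1 = pi_prod alpha k * varpi alpha k.+1.
  by rewrite /pi_prod big_nat_recr.
clearbody X Y; split.
- apply: size_mulC_le; rewrite (leq_trans (size_polyD _ _)) // geq_max sX.
  exact: size_mulC_le.
- apply: size_mulC_le; rewrite (leq_trans (size_polyD _ _)) // geq_max sY andbT.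
  exact: size_mulC_le.
- rewrite phi_rec pE rE piS tofracM tofracD tofracM XF YF /zeta -!/(rconst _).
  exact: (recurrence_frac _ _ _ _ _ (v0 k) (v0 k.+1) pk0).1.
rewrite star_rec pE rE piS tofracM tofracD tofracM XF YF /zeta -!/(rconst _).
exact: (recurrence_frac _ _ _ _ _ (v0 k) (v0 k.+1) pk0).2.
Qed.

Variables (n : nat) (v : C).
Hypothesis n_gt0 : (0 < n)%N.
Hypothesis v1 : `|v| = 1.

Local Notation Q := (para alpha phi n v).
Local Notation U := (op_mobius (principal (Amx alpha) n)
  (CMV_u a n ((v + a n) / (1 + (a n)^* * v)))).
Local Notation chi_row z := (\row_(k < n) reval (chi alpha phi k) z).
Local Notation para_at z := (phi_at phi z n + v * star_at alpha phi z n).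

Lemma evalto_para z : `|z| = 1 -> evalto Q z (para_at z).
Proof.
move=> z1; apply: evaltoD; first exact: (evalto_phi alpha_lt1 phi0 phi_rec star_rec z1).
apply: evaltoM; first exact: evalto_const.
exact: (evalto_star alpha_lt1 phi0 phi_rec star_rec z1).
Qed.

Lemma para_frac : exists q : {poly C}, (size q <= n.+1)%N /\ Q = q%:F / pi_prod alpha n.
Proof.
have [p [r [sp sr pE rE]]] := phi_frac n; exists (p + v%:P * r); split.
  by rewrite (leq_trans (size_polyD _ _)) // geq_max sp size_mulC_le.
by rewrite /para pE rE tofracD tofracM mulrDl mulrA.
Qed.

Lemma chi_row_neq0 z : `|z| = 1 -> chi_row z != 0.
Proof.
move=> z1; case: n n_gt0 => // m _; apply/eqP => /rowP/(_ ord0).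
rewrite !mxE -/(chi_at alpha phi z _) (chi_at0 alpha_lt1 phi0 phi_rec star_rec z1).
by move/eqP; rewrite oner_eq0.
Qed.

Lemma eigen_row z (x : 'rV[C]_n) : x *m U = z *: x -> x != 0 ->
  [/\ `|z| = 1, para_at z = 0 & exists2 c : C, c != 0 & x = c *: chi_row z].
Proof.
move=> xU x0; have z1 := unitary_eigenvalue_norm (op_mobius_CMV_unitary alpha_lt1 a_lt1
  n_gt0 v1) xU x0.
by have [] := eigen_chi_row alpha0 alpha_lt1 phi0 a_lt1 phi_rec star_rec z1 n_gt0 v1 xU
  x0.
Qed.

Lemma para_at_eigen z : `|z| = 1 -> para_at z = 0 -> chi_row z *m U = z *: chi_row z.
Proof. by move=> z1; exact: (chi_row_eigen alpha_lt1 phi0 a_lt1 phi_rec star_rec z1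
  n_gt0 v1). Qed.

Lemma para_at_root z : `|z| = 1 -> para_at z = 0 -> root (char_poly U) z.
Proof.
move=> z1 Qz; rewrite -eigenvalue_root_char; apply/eigenvalueP.
by exists (chi_row z); [exact: para_at_eigen|exact: chi_row_neq0].
Qed.

Lemma root_para_at z : root (char_poly U) z -> `|z| = 1 /\ para_at z = 0.
Proof.
rewrite -eigenvalue_root_char => /eigenvalueP[x xU x0].
by have [] := eigen_row xU x0.
Qed.

(** If the numerator were zero, every point of the circle would be an eigenvalue of U; but n + 1
    distinct points are too many for a characteristic polynomial of degree n. *)
Lemma para_num_neq0 (q : {poly C}) : Q = q%:F / pi_prod alpha n -> q != 0.
Proof.
move=> QE; apply/eqP => q0.
have all0 z : `|z| = 1 -> para_at z = 0.
  move=> z1; apply: evalto_eq (evalto_para z1) _.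
  by rewrite QE q0 tofrac0 mul0r; exact: evalto0.
have : (size [seq circle_point C t | t <- iota 0 n.+1] < size (char_poly U))%N.
  apply: max_poly_roots.
  - by rewrite monic_neq0 // char_poly_monic.
  - apply/allP => _ /mapP[t _ ->]; apply: para_at_root (norm_circle_point _ t) _.
    exact/all0/norm_circle_point.
  - by rewrite map_inj_uniq ?iota_uniq //; exact: circle_point_inj.
by rewrite size_map size_iota size_char_poly ltnn.
Qed.

Lemma para_atE (q : {poly C}) z : Q = q%:F / pi_prod alpha n -> `|z| = 1 ->
  root q z <-> para_at z = 0.
Proof.
move=> QE z1; have piz := pi_poly_circle n z1.
have -> : para_at z = q.[z] / (pi_poly n).[z].
  apply: evalto_eq (evalto_para z1) _.
  by exists q, (pi_poly n); rewrite -pi_prodE.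
rewrite /root; split=> [/eqP ->|/eqP]; first by rewrite mul0r.
by rewrite mulf_eq0 invr_eq0 (negbTE piz) orbF.
Qed.

Lemma para_spectrum : exists s : 'I_n -> C, [/\ injective s,
  (forall i, para_at (s i) = 0 /\ `|s i| = 1),
  (forall z, para_at z = 0 -> `|z| = 1 -> exists i, z = s i),
  (forall i j, \sum_k chi_row (s i) 0 k * (chi_row (s j) 0 k)^* =
     (i == j)%:R * \sum_k `|chi_row (s i) 0 k| ^+ 2) &
  (forall (h : C -> C) M,
     (forall z (x : 'rV[C]_n), x *m U = z *: x -> x *m M = h z *: x) ->
  forall j k, M j k = \sum_i (\sum_k `|chi_row (s i) 0 k| ^+ 2)^-1 *
     ((chi_row (s i) 0 j)^* * (h (s i) * chi_row (s i) 0 k)))].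
Proof.
apply: (@unitary_simple_spectrum _ _ U _ (fun z => para_at z = 0) (fun z => chi_row z)).
- exact: op_mobius_CMV_unitary.
- by move=> z _; exact: chi_row_neq0.
- by move=> z Qz z1; exact: para_at_eigen.
- by move=> z x xU x0; have [_] := eigen_row xU x0.
Qed.

(** Both polynomials have the n distinct roots [s i] and degree at most n, so each is its leading
    coefficient times the product of the X - s i. *)
Lemma para_num_char_poly (q : {poly C}) :
  (size q <= n.+1)%N -> Q = q%:F / pi_prod alpha n ->
  q = lead_coef q *: char_poly U.
Proof.
move=> sq QE; have [s [s_inj sQ _ _ _]] := para_spectrum.
pose rs := [seq s i | i <- enum 'I_n].
have urs : uniq rs by rewrite map_inj_uniq // enum_uniq.
have srs : size rs = n by rewrite size_map size_enum_ord.
have rq : all (root q) rs.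
  by apply/allP => _ /mapP[i _ ->]; have [Qs s1] := sQ i; apply/(para_atE QE).
have rc : all (root (char_poly U)) rs.
  by apply/allP => _ /mapP[i _ ->]; have [Qs s1] := sQ i; apply: para_at_root.
have q0 := para_num_neq0 QE.
have szq : size q = (size rs).+1.
  by apply/eqP; rewrite eqn_leq (max_poly_roots q0 rq urs) srs sq.
rewrite {1}(all_roots_prod_XsubC szq rq) ?uniq_rootsE //; congr (_ *: _).
rewrite [RHS](all_roots_prod_XsubC _ rc) ?uniq_rootsE ?srs ?size_char_poly //.
by rewrite (monicP (char_poly_monic _)) scale1r.
Qed.

(** A zero anywhere in the plane is a root of the numerator, which is a multiple of the
    characteristic polynomial of the unitary matrix U; hence it lies on the circle. *)
Lemma rzero_para z : rzero Q z <-> `|z| = 1 /\ para_at z = 0.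
Proof.
have [q [sq QE]] := para_frac; split=> [Qz|[z1 Qz]]; last first.
  by apply/(evalto_rzero (evalto_para z1)).
have qz : root q z.
  by apply: (rzero_num _ (pi_poly_neq0 n) Qz); rewrite -pi_prodE.
apply: root_para_at; move: qz; rewrite (para_num_char_poly sq QE).
by rewrite rootZ // lead_coef_eq0 (para_num_neq0 QE).
Qed.

Lemma rzero_eigenvalue z : rzero Q z <-> eigenvalue U z.
Proof.
rewrite rzero_para eigenvalue_root_char; split=> [[z1 Qz]|]; first exact: para_at_root.
exact: root_para_at.
Qed.

Lemma rzero_eigenvector z (x : 'cV[C]_n) : rzero Q z ->
  U *m x = z *: x <-> exists c : C, x = c *: (chi_row z) ^t*.
Proof.
move/rzero_para => [z1 Qz]; have Uu := op_mobius_CMV_unitary alpha_lt1 a_lt1 n_gt0 v1.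
rewrite -[x]trmxCK -(unitary_eigen_adj Uu _ z1) trmxCK; split=> [xU|[c ->]].
  have [x0|x0] := eqVneq (x ^t*) 0.
    by exists 0; rewrite scale0r -[x]trmxCK x0 trmx0 map_mx0.
  have [_ _ [c _ E]] := eigen_row xU x0; exists c^*.
  by rewrite -[x]trmxCK E adjmxZ.
by rewrite adjmxZ trmxCK -scalemxAl para_at_eigen // !scalerA mulrC.
Qed.

End ParaOrthogonal.

(** * Quadrature *)

Section Quadrature.
Variable R : realType.
Local Notation C := R[i].
Local Notation K := (R[i] : numFieldType).
Local Open Scope classical_set_scope.
Variables (alpha : nat -> C) (phi : nat -> ratfun R) (n : nat) (v : C).
Variable s : 'I_n -> C.
Hypothesis s_inj : injective s.
Hypothesis s_circle : forall i, `|s i| = 1.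
Hypothesis s_zero : forall z, rzero (para alpha phi n v) z <-> exists i, z = s i.

Local Notation zs := (para_zeros alpha phi n v).
Local Notation nu := (para_measure alpha phi n v).
Local Notation w z := (christoffel phi n z).

(** [fset_set] is empty by default on infinite sets, so finiteness is needed to recover the zeros
    from [para_zeros]. *)
Lemma finite_para_zeros : finite_set [set z : C | rzero (para alpha phi n v) z].
Proof.
apply: (@sub_finite_set _ _ [set` [seq s i | i <- enum 'I_n]]); last exact: finite_seq.
by move=> z /s_zero[i ->] /=; apply: map_f; rewrite mem_enum.
Qed.

Lemma perm_para_zeros : perm_eq zs [seq s i | i <- enum 'I_n].
Proof.
apply: uniq_perm.
- exact: finmap.fset_uniq.
- by rewrite map_inj_uniq // enum_uniq.
move=> z; rewrite [LHS]in_fset_set; last exact: finite_para_zeros.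
apply/idP/mapP => [|[i _ ->]]; rewrite inE /=.
  by move=> /s_zero[i ->]; exists i; rewrite ?mem_enum.
by apply/s_zero; exists i.
Qed.

Lemma sum_para_zeros (g : C -> R) : \sum_(i < size zs) g zs`_i = \sum_(i < n) g (s i).
Proof.
rewrite -(big_mkord xpredT (fun i => g zs`_i)) -(big_nth 0 xpredT g).
by rewrite (perm_big _ perm_para_zeros) big_map big_enum.
Qed.

Lemma circle_para_zeros i : (i < size zs)%N -> @unit_circle R zs`_i.
Proof.
move=> /(mem_nth 0); rewrite (perm_mem perm_para_zeros) => /mapP[j _ ->].
exact: s_circle.
Qed.

Lemma integral_para (g : borelC R -> R) : measurable_fun (@unit_circle R) g ->
  (\int[nu]_(z in @unit_circle R) (g z)%:E = (\sum_(i < n) w (s i) * g (s i))%:E)%E.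
Proof.
move=> mg; rewrite [LHS]integral_discrete //.
- by rewrite /= (sum_para_zeros (fun z => w z * g z)).
- exact: measurable_unit_circle.
- exact: circle_para_zeros.
Qed.

Lemma measurable_continuous_circle (h : K -> K) :
  (forall z, `|z| = 1 -> {for z, continuous h}) ->
  measurable_fun (@unit_circle R) (fun z : borelC R => complex.Re (h z)) /\
  measurable_fun (@unit_circle R) (fun z : borelC R => complex.Im (h z)).
Proof.
move=> ch; split; apply: continuous_on_measurable.
- exact: closed_unit_circle.
- by move=> z z1; apply: (continuous_comp (ch z z1)); exact: Re_continuous.
- exact: closed_unit_circle.
- by move=> z z1; apply: (continuous_comp (ch z z1)); exact: Im_continuous.
Qed.

Lemma cintegral_para (h : K -> K) : (forall z, `|z| = 1 -> {for z, continuous h}) ->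
  cintegral nu h = \sum_(i < n) (w (s i))%:C%C * h (s i).
Proof.
move=> ch; have [mRe mIm] := measurable_continuous_circle ch.
rewrite /cintegral /Rintegral !integral_para //=.
apply/eqP; rewrite eq_complex /= !raddf_sum /=.
by apply/andP; split; apply/eqP; apply: eq_bigr => i _; case: (h (s i)) => x y /=; ring.
Qed.

Variable chi : 'I_n -> K -> K.
Hypothesis chi_cont : forall k z, `|z| = 1 -> {for z, continuous (chi k)}.
(** This and [chi_rows] are the column and row relations of the unitary matrix with entries
    sqrt(w(s_i)) chi_k(s_i). *)
Hypothesis chi_cols : forall j k,
  \sum_i (w (s i))%:C%C * ((chi j (s i))^* * chi k (s i)) = (j == k)%:R.
Hypothesis chi_rows : forall i j,
  (w (s j))%:C%C * \sum_k (chi k (s i) * (chi k (s j))^*) = (i == j)%:R.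

Lemma inner_cont j (g : K -> K) : (forall z, `|z| = 1 -> {for z, continuous g}) ->
  inner nu (chi j) g = \sum_i (w (s i))%:C%C * ((chi j (s i))^* * g (s i)).
Proof.
move=> cg.
have ch z : `|z| = 1 -> {for z, continuous (fun z : K => (chi j z)^* * g z : K)}.
  move=> z1.
  have c1 : {for z, continuous (fun z : K => (chi j z)^* : K)}.
    exact: (@continuous_comp K K K (chi j) (fun t : K => t^* : K) z
      (chi_cont z1) (@conj_continuous R (chi j z))).
  exact: (continuousM c1 (cg z z1)).
exact: (cintegral_para ch).
Qed.

Lemma chi_L2 k : L2 nu (chi k).
Proof.
have [mRe mIm] := measurable_continuous_circle (@chi_cont k).
split=> //; rewrite integral_para ?ltry //.
by apply: measurable_funD; apply: measurable_funX.
Qed.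

Lemma para_measure_ae (P : C -> Prop) : (forall i, P (s i)) -> {ae nu, forall z, P z}.
Proof.
(* The complement of the zeros carries no mass and is measurable, finite sets being closed. *)
move=> Ps; exists (~` [set` [seq s i | i <- enum 'I_n]]); split.
- apply: measurableC; rewrite -[X in measurable X]setCK; apply: measurableC.
  apply: sub_sigma_algebra; apply/closed_openC.
  have /accessible_finite_set_closed := hausdorff_accessible (@norm_hausdorff K K).
  by apply; exact: finite_seq.
- rewrite /para_measure /= /msum big1 // => i _.
  transitivity ((w zs`_i)%:E * \d_(zs`_i : borelC R) (~` [set` [seq s i | i <- enum
    'I_n]]))%E.
    by [].
  rewrite diracE memNset ?mule0 //; apply.
  by rewrite /= -(perm_mem perm_para_zeros) mem_nth.
- move=> z /= nP; apply: contra_not nP => /mapP[i _ ->]; exact: Ps.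
Qed.

Lemma chi_orthonormal_basis : orthonormal_basis nu chi.
Proof.
split; first split.
- exact: chi_L2.
- by move=> j k; rewrite (inner_cont j (@chi_cont k)).
(* The coefficients are the inner products of g with the chi_k, written as finite sums because g
   need not be continuous. The row relations reproduce g at every zero. *)
move=> g _; exists (fun k => \sum_j (w (s j))%:C%C * ((chi k (s j))^* * g (s j))).
apply: para_measure_ae => i _.
under eq_bigr do rewrite mulr_suml.
rewrite exchange_big /= (bigD1 i) //= [X in _ + X]big1 => [|j ji].
  rewrite addr0; transitivity
    ((w (s i))%:C%C * (\sum_k chi k (s i) * (chi k (s i))^*) * g (s i)).
    by rewrite chi_rows eqxx mul1r.
  by rewrite mulr_sumr mulr_suml; apply: eq_bigr => k _; ring.
transitivity ((w (s j))%:C%C * (\sum_k chi k (s i) * (chi k (s j))^*) * g (s j)).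
  by rewrite mulr_sumr mulr_suml; apply: eq_bigr => k _; ring.
by rewrite chi_rows eq_sym (negbTE ji) mul0r.
Qed.

Lemma chi_matrix_mult (M : 'M[C]_n) :
  (forall j k, M j k = \sum_i (w (s i))%:C%C * ((chi j (s i))^* * (s i * chi k (s i)))) ->
  is_matrix_of nu (@mult_op R) chi M.
Proof.
move=> ME; split; first exact: chi_orthonormal_basis.
move=> j k; rewrite ME (@inner_cont j (fun z => z * chi k z)) // => z z1.
by apply: continuousM; [exact: cvg_id|exact: chi_cont].
Qed.

End Quadrature.

(* Assembly of the matrix, the eigenvectors and the characteristic polynomial *)
Local Close Scope sesquilinear_scope.

Theorem theorem5p9 (R : realType) (alpha : nat -> R[i])
    (mu : probability (borelC R) R)
    (phi : nat -> ratfun R) (a : nat -> R[i]) (n : nat) (v : R[i]) :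
  alpha 0%N = 0 ->
  (forall k, (0 < k)%N -> `|alpha k| < 1) ->
  circle_measure mu ->
  is_ORF alpha mu phi a ->
  (0 < n)%N ->
  `|v| = 1 ->
  let Q := para alpha phi n v in
  let u := (v + a n) / (1 + (a n)^* * v) in
  let U : 'M[R[i]]_n := op_mobius (principal (Amx alpha) n) (CMV_u a n u) in
  [/\ is_matrix_of (para_measure alpha phi n v) (@mult_op R)
        (fun k : 'I_n => reval (chi alpha phi k)) U,
      (forall l : R[i], rzero Q l <-> eigenvalue U l) /\
      (forall l : R[i], rzero Q l -> forall x : 'cV[R[i]]_n,
         U *m x = l *: x <->
         exists c : R[i],
           x = c *: (\row_(k < n) reval (chi alpha phi k) l) ^t*%sesqui) &
      exists q : {poly R[i]},
        Q = q%:F / pi_prod alpha n /\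
        exists c : R[i], c != 0 /\ q = c *: char_poly U].
Proof.
move=> alpha0 alpha_pos _ [_ _ phi0 rec] n_gt0 v1 Q u U.
have alpha_lt1 k : `|alpha k| < 1.
  by case: k => [|k]; [rewrite alpha0 normr0|exact: alpha_pos].
have a_lt1 k : `|a k.+1| < 1 by have [] := rec k.+1 isT.
have phi_rec k : phi k.+1 =
    rconst (enorm alpha a k.+1) * (varpi alpha k / varpi alpha k.+1) *
    (zeta alpha k * phi k + rconst (a k.+1) * superstar alpha phi k).
  by have [] := rec k.+1 isT.
have star_rec k : superstar alpha phi k.+1 =
    rconst (enorm alpha a k.+1) * (varpi alpha k / varpi alpha k.+1) *
    (rconst (a k.+1)^* * (zeta alpha k * phi k) + superstar alpha phi k).
  by have [] := rec k.+1 isT.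
split.
- have [s [s_inj sQ s_all rows mats]] := para_spectrum alpha0 alpha_lt1 phi0 a_lt1
    phi_rec star_rec n_gt0 v1.
  (* As |chi_k| = |phi_k| on the circle, the mass at [s i] is the inverse of the squared norm of the
     row chi(s i). *)
  have wE i : (christoffel phi n (s i))%:C%C =
      (\sum_k `|(\row_(k < n) reval (chi alpha phi k) (s i)) 0 k| ^+ 2)^-1.
    rewrite /christoffel fmorphV rmorph_sum /=; congr (_^-1); apply: eq_bigr => k _.
    rewrite mxE (norm_chi_at alpha_lt1 phi0 phi_rec star_rec (sQ i).2) /phi_at.
    by rewrite /normsq add_Re2_Im2.
  apply: (@chi_matrix_mult _ alpha phi n v s s_inj).
  + by move=> i; have [] := sQ i.
  + move=> z; apply: (iff_trans (rzero_para alpha0 alpha_lt1 phi0 a_lt1 phi_rec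
    star_rec n_gt0 v1 z)).
    split=> [[z1 Qz]|[i ->]]; first exact: s_all.
    by have [] := sQ i.
  + move=> k z z1; apply: reval_continuous.
    exact: (evalto_rden (evalto_chi alpha_lt1 phi0 phi_rec star_rec z1 k)).
  (* The expansion for M = 1 and h = 1 is the orthonormality of the chi_k for the discrete
     measure. *)
  + move=> j k; have m1 z (x : 'rV[R[i]]_n) : x *m U = z *: x -> x *m 1%:M = 1 *: x.
      by rewrite mulmx1 scale1r.
    have := mats (fun=> 1) 1%:M m1 j k; rewrite mxE => ->.
    by apply: eq_bigr => i _; rewrite wE !mxE mul1r.
  + move=> i j; rewrite wE; have := rows i j.
    under eq_bigr do rewrite !mxE.
    move=> ->; have [->|_] := eqVneq i j; last by rewrite mul0r mulr0.
    rewrite mul1r mulVf //.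
    have := chi_row_neq0 alpha_lt1 phi0 phi_rec star_rec n_gt0 (sQ j).2.
    apply: contraNneq => /psumr_eq0P H; apply/eqP/rowP => k; rewrite [RHS]mxE.
    have /eqP := H (fun k _ => exprn_ge0 2 (normr_ge0 _)) k isT.
    by rewrite expf_eq0 /= normr_eq0 => /eqP.
  (* The expansion for M = U and h = id gives the entries of U as quadrature sums. *)
  + move=> j k; rewrite (mats id) //.
    by apply: eq_bigr => i _; rewrite wE !mxE.
- split=> l; first exact: rzero_eigenvalue.
  by move=> Ql x; exact: rzero_eigenvector.
have [q [sq QE]] := para_frac alpha_lt1 phi0 phi_rec star_rec n v.
exists q; split; first exact: QE.
exists (lead_coef q); split.
  by rewrite lead_coef_eq0 (para_num_neq0 alpha_lt1 phi0 a_lt1 phi_rec star_rec n_gt0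
    v1 QE).
exact: (para_num_char_poly alpha0 alpha_lt1 phi0 a_lt1 phi_rec star_rec n_gt0 v1 sq QE).
Qed.
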